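(* Let $K$ be a field and let $A$ be a finitely generated $K$-algebra that is a domain with $\mathrm{GKdim}(A)<3$, and let $Q(A)$ be its quotient division algebra. If $D$ is a division $K$-subalgebra of $Q(A)$ with $\mathrm{GKdim}(D)\ge 2$, then $Q(A)$ is finite dimensional as a left $D$-vector space.
   Context: For a finitely generated $K$-algebra $A$, $\mathrm{GKdim}(A)=\limsup_{n\to\infty}\log\dim_K(V^n)/\log n$, where $V$ is any finite-dimensional subspace containing $1$ that generates $A$ as a $K$-algebra. For an arbitrary $K$-algebra $B$ (e.g. a division algebra that is not finitely generated as an algebra), $\mathrm{GKdim}(B)$ is the supremum of the GK dimensions of its finitely generated $K$-subalgebras. A finitely generated domain of finite GK dimension is an Ore domain and has a quotient division algebra $Q(A)$. *)

(* Defs.v *)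
From HB Require Import structures.
From mathcomp Require Import all_boot all_order all_algebra.
From mathcomp Require Import all_classical all_reals all_analysis.
From mathcomp Require Import Rstruct Rstruct_topology.
Set Implicit Arguments. Unset Strict Implicit. Unset Printing Implicit Defensive.
Import Order.TTheory GRing.Theory Num.Theory.
Local Open Scope ring_scope.

Section LinAlg.
Variables (K : fieldType) (V : lmodType K).

Definition in_span (ws : seq V) (x : V) : Prop :=
  exists c : 'I_(size ws) -> K, x = \sum_(i < size ws) c i *: ws`_i.

Definition lin_indep (vs : seq V) : Prop :=
  forall c : 'I_(size vs) -> K,
    \sum_(i < size vs) c i *: vs`_i = 0 -> forall i, c i = 0.

Definition dimspan (ws : seq V) : nat :=
  \max_(b : (size ws).-tuple bool | `[< lin_indep (mask b ws) >])
     size (mask b ws).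
End LinAlg.

Section Algebra.
Variables (K : fieldType) (Q : unitAlgType K).

(* spanning family of V^n, where V = span (1 :: s):
   all products of n elements of 1 :: s *)
Fixpoint pow_gens (s : seq Q) (n : nat) : seq Q :=
  if n is m.+1 then [seq x * y | x <- pow_gens s m, y <- 1 :: s]
  else [:: 1].

Definition growth_fun (s : seq Q) (n : nat) : nat := dimspan (pow_gens s n).

Definition gk_growth (s : seq Q) : \bar Rdefinitions.R :=
  limn_esup (fun n => ((ln ((growth_fun s n)%:R : Rdefinitions.R))
                        / ln (n%:R : Rdefinitions.R))%:E).

Definition generated_by (A : Q -> Prop) (s : seq Q) : Prop :=
  forall x, A x <-> exists n, in_span (pow_gens s n) x.

Definition GKdim (B : Q -> Prop) : \bar Rdefinitions.R :=
  ereal_sup [set gk_growth s | s in [set s : seq Q | forall x, x \in s -> B x]].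

Definition is_subalgebra (B : Q -> Prop) : Prop :=
  B 1 /\ (forall x y, B x -> B y -> B (x + y)) /\
  (forall x y, B x -> B y -> B (x * y)) /\
  (forall (k : K) x, B x -> B (k *: x)).

Definition is_division_subalgebra (B : Q -> Prop) : Prop :=
  is_subalgebra B /\ (forall x, B x -> x != 0 -> B x^-1).

Definition is_division_algebra : Prop :=
  forall x : Q, x != 0 -> x \is a GRing.unit.

Definition is_quotient_division_algebra_of (A : Q -> Prop) : Prop :=
  is_division_algebra /\ is_subalgebra A /\
  forall q : Q, exists a b, A a /\ A b /\ b != 0 /\ q = a * b^-1.

Definition left_fin_dim_over (D : Q -> Prop) : Prop :=
  exists e : seq Q, forall q : Q,
    exists d : 'I_(size e) -> Q, (forall i, D (d i)) /\
      q = \sum_(i < size e) d i * e`_i.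
End Algebra.

(* Main.v *)
From HB Require Import structures.
Require Import Defs.
From mathcomp Require Import all_boot all_order all_algebra.
From mathcomp Require Import all_classical all_reals all_analysis.
From mathcomp Require Import Rstruct Rstruct_topology.
From mathcomp Require Import zify lra.
Set Implicit Arguments. Unset Strict Implicit. Unset Printing Implicit Defensive.
Import Order.TTheory GRing.Theory Num.Theory.
Local Open Scope ring_scope.

(** Write V for the span of 1 and s, v(n) = dim V^n, and suppose Q is infinite
    dimensional over D on the left.  Let W be a finite-dimensional subspace of D
    containing 1.  Clearing denominators by some b gives W b V^n inside V^(n+m), and
    since v(n) = o(n^3) there are infinitely many n for which E = b V^n (and
    likewise b V^(2n)) is almost stable under W: dim (W E + E) - dim E <= t with
    t <= C v(n) / n.  A path is a sequence of products p_0 = 1, p_1, p_2, ... in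
    which each term is obtained from the previous one by multiplying by an
    element of W.  If p'_(i+1) = eta_i p'_i, then asking p'_i g to stay in E for
    all i < r costs at most r t linear conditions, so some g <> 0 in E survives
    as soon as r t < dim E.  If p_(a+1) = p_a xi_a, then the sum of the p_a b V^(2n)
    for a < r has dimension at most v(2n) + r t'.  It contains all the
    p_a p'_i g V^n, and D g V^n has left dimension at least n + 1 over D, because
    otherwise D g V^k would be stable under V for some k, hence equal to Q.  So
    if the r^2 products p_a p'_i are independent, then
    r^2 (n + 1) <= v(2n) + r t', which for r ~ n / 2C contradicts v(n) = o(n^3).

    Independent products exist as soon as dim W^n / n is unbounded: order words
    in the letters spanning W lexicographically, and call a word reduced if it is
    not, modulo shorter words, a combination of larger words.  Reduced words are
    closed under factors.  If for some m the j-th letter of a reduced word of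
    length m were determined by the previous letters, then long reduced words
    would be determined by boundedly many letters and dim W^n would be O(n); so
    reduced words of every length branch at every position.  Take the factors
    xi_a and eta_i to be combinations of letters with generic coefficients.
    Degenerating the coefficients along the lexicographic order replaces W^m by
    its reduced words, and the branching then makes the m + 1 products of total
    length m independent.  As K may be finite, the coefficients are taken in K[z]
    and the linear algebra is done over K[z] in Q[z]. *)

(** * Minors and words *)

Section Minors.
Variable B : idomainType.

Lemma det_neq0_free n (M : 'M[B]_n) (l : 'I_n -> B) :
  \det M != 0 -> (forall j, \sum_i l i * M i j = 0) -> forall i, l i = 0.
Proof.
move=> dM lM i; apply/eqP/negPn/negP => li; move/negP: dM; apply.
apply/det0P; exists (\row_k l k).
  by apply: contra li => /eqP/rowP/(_ i); rewrite !mxE => ->.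
apply/rowP => j; rewrite !mxE -[RHS](lM j).
by apply: eq_bigr => k _; rewrite mxE.
Qed.

(** Induction on the number of rows: if no column enlarged a nonzero minor of the first [k] rows,
    the cofactors would form a relation among all rows whose last coefficient is that minor. *)
Lemma minor_neq0 (T : Type) (P : T -> Prop) k (M : 'I_k -> T -> B) :
  (forall l : 'I_k -> B,
     (forall v, P v -> \sum_i l i * M i v = 0) -> forall i, l i = 0) ->
  exists f : 'I_k -> T, \det (\matrix_(i, j) M i (f j)) != 0.
Proof.
elim: k M => [M _|k IH M free].
  have f : 'I_0 -> T by case.
  by exists f; rewrite det_mx00 oner_neq0.
have [l' l'0|f df] := IH (fun i => M (lift ord_max i)).
  pose l i := if unlift ord_max i is Some j then l' j else 0.
  move=> i; have := free l _ (lift ord_max i); rewrite /l liftK; apply => v Pv.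
  rewrite (bigD1_ord ord_max) //= unlift_none mul0r add0r -[RHS](l'0 v Pv).
  by apply: eq_bigr => j _; rewrite liftK.
(* In the expansion along a last column [v], the cofactors [F] do not depend on [v]. *)
pose fv v (j : 'I_k.+1) := if unlift ord_max j is Some j' then f j' else v.
pose F (i : 'I_k.+1) : B := (-1) ^+ (i + k) *
  \det (row' i (\matrix_(i < k.+1, j < k) M i (f j))).
have detE v : \det (\matrix_(i, j) M i (fv v j)) = \sum_i F i * M i v.
  rewrite (expand_det_col _ ord_max); apply: eq_bigr => i _.
  rewrite mxE /fv unlift_none mulrC; congr (_ * _); rewrite /cofactor /F.
  congr (_ * \det _); apply/matrixP => a b; rewrite !mxE liftK.
  by congr (M _ _).
apply: contrapT => nex.
have /free/(_ ord_max) : forall v, P v -> \sum_i F i * M i v = 0.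
  move=> v Pv; rewrite -detE; apply/eqP/negPn/negP => dv.
  by apply: nex; exists (fv v).
apply/eqP; rewrite mulf_neq0 //; first by rewrite signr_eq0.
congr (\det _ != 0): df; apply/matrixP => a b; rewrite !mxE.
by congr (M _ _).
Qed.

End Minors.

Section Words.
Variable d : nat.
Implicit Types u v : seq 'I_d.

Fixpoint words m : seq (seq 'I_d) :=
  if m is m'.+1 then [seq x :: u | x <- enum 'I_d, u <- words m'] else [:: [::]].

Lemma mem_words m u : (u \in words m) = (size u == m).
Proof.
elim: m u => [|m IH] [|x u] //=.
  by apply/negbTE/negP => /allpairsP[[y v] [_ _]].
apply/allpairsP/idP => [[[y v] /= [_ + [_ ->]]]|]; first by rewrite IH.
by rewrite eqSS -IH => uw; exists (x, u); rewrite mem_enum.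
Qed.

Lemma words_uniq m : uniq (words m).
Proof.
elim: m => //= m IH; apply: allpairs_uniq => //; first exact: enum_uniq.
by move=> [x u] [y v] _ _ [-> ->].
Qed.

Lemma size_words m : size (words m) = (d ^ m)%N.
Proof. by elim: m => //= m IH; rewrite size_allpairs size_enum_ord IH expnS. Qed.

Lemma big_words (V : nmodType) m (F : seq 'I_d -> V) :
  \sum_(u <- words m.+1) F u = \sum_x \sum_(u <- words m) F (x :: u).
Proof. by rewrite /= big_allpairs_dep /= [LHS]big_enum. Qed.

(* On words of a fixed length, comparing wval is comparing lexicographically. *)
Fixpoint wval u : nat := if u is x :: u' then (x * d ^ size u' + wval u')%N else 0%N.

Lemma wval_lt u : (wval u < d ^ size u)%N.
Proof.
elim: u => //= x u IH.
apply: (@leq_trans (x.+1 * d ^ size u)%N); first by rewrite mulSn addnC ltn_add2r.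
by rewrite expnS leq_mul2r ltn_ord orbT.
Qed.

Lemma wval_cat u v : wval (u ++ v) = (wval u * d ^ size v + wval v)%N.
Proof.
elim: u => //= x u ->.
by rewrite size_cat mulnDl -mulnA -expnD addnA.
Qed.

Lemma wval_inj u v : size u = size v -> wval u = wval v -> u = v.
Proof.
elim: u v => [|x u IH] [|y v] //= [suv] E.
have dp : (0 < d ^ size v)%N by rewrite (leq_ltn_trans _ (wval_lt v)).
have Exy : x = y :> nat.
  have := congr1 (divn^~ (d ^ size v)%N) E.
  rewrite suv !divnMDl // [(wval u %/ _)%N]divn_small ?[(wval v %/ _)%N]divn_small ?wval_lt //.
    by rewrite !addn0.
  by rewrite -suv wval_lt.
have -> : x = y by apply/val_inj.
congr (_ :: _); apply: IH => //; apply/eqP.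
by move/eqP: E; rewrite Exy suv eqn_add2l.
Qed.

(** Turns a prefix into an exponent: two words that agree on their first j letters have different
    sums over j + 1 letters exactly when their letters at position j differ. *)
Definition wsum u := sumn [seq nat_of_ord x | x <- u].

Section Weights.
Variable B : comPzRingType.
Implicit Types cs : seq ('I_d -> B).

(** For lists of equal length, the coefficient of [u] in the product of the linear combinations of
    letters with coefficients [cs]. *)
Fixpoint wt cs u : B :=
  match cs, u with c :: cs', x :: u' => c x * wt cs' u' | _, _ => 1 end.

Lemma wt_cat cs1 cs2 u1 u2 : size cs1 = size u1 ->
  wt (cs1 ++ cs2) (u1 ++ u2) = wt cs1 u1 * wt cs2 u2.
Proof.
elim: cs1 u1 => [|c cs IH] [|x u] //= => [_|[/IH ->]]; first by rewrite mul1r.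
by rewrite mulrA.
Qed.

(** The second part is reversed because the path of the eta_i grows by multiplication on the
    left. *)
Definition coef_list (x y : nat -> 'I_d -> B) a i := mkseq x a ++ rev (mkseq y i).

Lemma size_coef_list x y a i : size (coef_list x y a i) = (a + i)%N.
Proof. by rewrite size_cat size_rev !size_mkseq. Qed.

End Weights.

Lemma wt_morph (B B' : comPzRingType) (phi : {rmorphism B -> B'}) cs u :
  phi (wt cs u) = wt [seq phi \o c | c <- cs] u.
Proof.
elim: cs u => [|c cs IH] [|x u] /=; rewrite ?rmorph1 //.
by rewrite rmorphM IH.
Qed.

(** * Generic coefficients and their specializations *)

Section Gamma.
Variables (K : fieldType) (g : seq 'I_d -> seq 'I_d -> K).

Section Matrix.
Variables (B : comPzRingType) (h : K -> B).

(* [g u v] will be the coefficient of [v] in the normal form of [u], and [wmat x y m a v]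
   the coefficient of [v] in xi_0 ... xi_(a-1) eta_(m-a-1) ... eta_0, where [x j], [y j]
   list the coefficients of xi_j and eta_j. *)
Definition wmat (x y : nat -> 'I_d -> B) m a v : B :=
  \sum_(u <- words m) wt (coef_list x y a (m - a)) u * h (g u v).

(** With [g] the normal form, a nonzero minor expresses that the m + 1 products of total length [m]
    are independent modulo shorter words, in a form that survives lifting and generic
    specialization. *)
Definition good x y m := exists f : 'I_m.+1 -> seq 'I_d,
  \det (\matrix_(a < m.+1, b < m.+1) wmat x y m a (f b)) != 0.

End Matrix.

Lemma wmat_morph (B B' : comPzRingType) (phi : {rmorphism B -> B'}) (h : K -> B)
    (x y : nat -> 'I_d -> B) (x' y' : nat -> 'I_d -> B') (h' : K -> B') m a v :
  (forall k, phi (h k) = h' k) ->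
  (forall j c, phi (x j c) = x' j c) -> (forall j c, phi (y j c) = y' j c) ->
  phi (wmat h x y m a v) = wmat h' x' y' m a v.
Proof.
move=> hE xE yE; rewrite rmorph_sum; apply: eq_bigr => u _.
rewrite rmorphM hE wt_morph; congr (wt _ _ * _).
rewrite /coef_list map_cat map_rev /mkseq -!map_comp.
by congr (_ ++ rev _); apply: eq_map => j /=; apply/funext => c /=.
Qed.

Section Infinite.
Variables (A : idomainType) (h : K -> A) (e : nat -> A).
Hypothesis e_inj : injective e.

Let hP (k : K) : {poly A} := (h k)%:P.

Lemma good_horner (x y : nat -> 'I_d -> {poly A}) m t
    (f : 'I_m.+1 -> seq 'I_d) :
  \det (\matrix_(a < m.+1, b < m.+1)
     wmat h (fun j c => (x j c).[t]) (fun j c => (y j c).[t]) m a (f b)) =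
  (\det (\matrix_(a < m.+1, b < m.+1) wmat hP x y m a (f b))).[t].
Proof.
rewrite -[RHS]/(horner_eval t _) -det_map_mx; congr (\det _).
apply/matrixP => a b; rewrite !mxE; symmetry; apply: wmat_morph => // k.
by rewrite /= /horner_eval hornerC.
Qed.

Lemma ex_nonroot (p : {poly A}) : p != 0 -> exists t, p.[t] != 0.
Proof.
move=> p0; apply: contrapT => nt.
have := max_poly_roots (rs := mkseq e (size p)) p0.
rewrite mkseq_uniq // size_mkseq ltnn => /(_ _ isT) H.
suff /H : all (root p) (mkseq e (size p)) by [].
apply/allP => t _; apply/rootP/eqP/negPn/negP => pt; apply: nt.
by exists t.
Qed.

(** The product of the finitely many chosen minors is a nonzero polynomial; a point where it does
    not vanish serves all lengths at once. *)
Lemma good_specialize (ms : seq nat) (x y : nat -> 'I_d -> {poly A}) :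
  (forall m, m \in ms -> good hP x y m) ->
  exists t, forall m, m \in ms ->
    good h (fun j c => (x j c).[t]) (fun j c => (y j c).[t]) m.
Proof.
move=> gms.
suff [p p0 pP] : exists2 p : {poly A}, p != 0 & forall t, p.[t] != 0 ->
    forall m, m \in ms ->
    good h (fun j c => (x j c).[t]) (fun j c => (y j c).[t]) m.
  by have [t /pP ?] := ex_nonroot p0; exists t.
elim: ms gms => [|m ms IH] gms; first by exists 1; rewrite ?oner_neq0.
have [k km|p p0 pP] := IH _; first by apply: gms; rewrite inE km orbT.
have [|f df] := gms m; first by rewrite mem_head.
exists (p * \det (\matrix_(a < m.+1, b < m.+1) wmat hP x y m a (f b))).
  by rewrite mulf_neq0.
move=> t; rewrite hornerM mulf_eq0 negb_or => /andP[pt dt] k.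
rewrite inE => /predU1P[->|]; last exact: pP.
by exists f; rewrite good_horner.
Qed.

(** A minor whose value at [t] is nonzero is a nonzero polynomial. *)
Lemma good_lift (x y : nat -> 'I_d -> {poly A}) x' y' m t :
  good h x' y' m -> (forall j c, (x j c).[t] = x' j c) ->
  (forall j c, (y j c).[t] = y' j c) -> good hP x y m.
Proof.
move=> [f df] xE yE; exists f; apply: contra df => /eqP df.
have -> : x' = (fun j c => (x j c).[t]) by do 2!apply/funext => ?.
have -> : y' = (fun j c => (y j c).[t]) by do 2!apply/funext => ?.
by rewrite good_horner df horner0.
Qed.

End Infinite.

(** * Degeneration along the lexicographic order *)

Section Triangular.
Variable red : seq 'I_d -> Prop.
Hypothesis g_diag : forall v, red v -> g v v = 1.
Hypothesis g_tri : forall u v, red v -> size u = size v -> g u v != 0 ->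
  u = v \/ (wval u < wval v)%N.
Hypothesis red_nil : red [::].
Hypothesis branch : forall m j, (j < m)%N -> exists v v',
  [/\ red v, red v', size v = m, size v' = m &
      take j v = take j v' /\ wsum (take j.+1 v) <> wsum (take j.+1 v')].

(** Descending induction on [a]. Subtracting the relations for two words that branch at position [j]
    cancels the terms with a <= j, those with a > j + 1 vanish already, and what remains is
    [mu j.+1] times a nonzero difference of monomials. *)
Lemma branch_elim m (mu : nat -> {poly K}) :
  (forall v, red v -> size v = m ->
     \sum_(a < m.+1) mu a * 'X^(wsum (take a v)) = 0) ->
  forall a, (a <= m)%N -> mu a = 0.
Proof.
move=> mu0.
have key j : (j <= m)%N -> (forall b, (j < b <= m)%N -> mu b = 0) -> mu j = 0.
  case: j => [|j] jm hb.
    have [v [rv sv]] : exists v, red v /\ size v = m.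
      case: (m) branch => [|m'] br; first by exists [::].
      by have [v [v' [rv _ sv _ _]]] := br m'.+1 0%N isT; exists v.
    have := mu0 v rv sv; rewrite big_ord_recl /= big1 => [|i _].
      by rewrite take0 addr0 mulr1.
    by rewrite hb ?mul0r //=; apply: ltn_ord.
  have [v [v' [rv rv' sv sv' [E N]]]] := branch jm.
  have := mu0 v rv sv; rewrite -[RHS](mu0 v' rv' sv') => /eqP.
  rewrite -subr_eq0 -sumrB (bigD1 (Ordinal (jm : (j.+1 < m.+1)%N))) //= big1.
    rewrite addr0 -mulrBr mulf_eq0 => /orP[/eqP//|].
    rewrite subr_eq0 => /eqP/(congr1 (fun p : {poly K} => size p)).
    by rewrite !size_polyXn => -[].
  move=> i ij; have [ji|ij'] := ltnP j.+1 i.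
    by rewrite hb ?mul0r ?subr0 // ji -ltnS ltn_ord.
  have {}ij : (i <= j)%N.
    rewrite -ltnS ltn_neqAle ij' andbT.
    by apply: contra ij => /eqP ij; apply/eqP/val_inj.
  have -> : take i v = take i v' by rewrite -(take_takel _ ij) E take_takel.
  by rewrite subrr.
suff H k a : (m < k + a)%N -> (a <= m)%N -> mu a = 0.
  by move=> a am; apply: (H m.+1) => //; rewrite addSn ltnS leq_addr.
elim: k a => [|k IH] a ka am; first by rewrite ltnNge am in ka.
apply: key => // b /andP[ab bm]; apply: IH => //; lia.
Qed.

(* Powers of the outer variable implement the lexicographic degeneration, so their exponent
   depends only on the position of the letter in a word of length [m]; powers of the inner
   variable tell [pow_x] from [pow_y]. *)
Definition pow_x m j (c : 'I_d) : {poly {poly K}} :=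
  'X^(c * d ^ (m - j.+1)) * ('X^c)%:P.
Definition pow_y i (c : 'I_d) : {poly {poly K}} := 'X^(c * d ^ i).

Lemma wt_pow_x m k a (u : seq 'I_d) : size u = a -> (k + a <= m)%N ->
  wt [seq pow_x m j | j <- iota k a] u = 'X^(wval u * d ^ (m - k - a)) * ('X^(wsum u))%:P.
Proof.
elim: a k u => [|a IH] k [|x u] //= => [_ _|[su] kam].
  by rewrite mul0n !expr0 mul1r.
rewrite IH ?addSn -?addnS // su /wsum /= exprD polyCM mulrACA -exprD.
congr ('X^_ * _); rewrite mulnDl -mulnA -expnD.
by congr (_ * _ ^ _ + _ * _ ^ _)%N; lia.
Qed.

Lemma wt_pow_y i (u : seq 'I_d) : size u = i ->
  wt (rev (mkseq pow_y i)) u = 'X^(wval u).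
Proof.
elim: i u => [|i IH] [|x u] //= [su].
by rewrite mkseqS rev_rcons /= IH // -exprD su.
Qed.

(** Given a relation [l] among the rows, let [mu] be its top coefficients in the outer variable. In
    column [v] every contributing word other than [v] has smaller [wval], so the highest outer
    coefficient sees only [v] itself and yields the relation treated in [branch_elim]. *)
Lemma good_pow m : good (fun k => k%:P%:P) (pow_x m) pow_y m.
Proof.
pose h (k : K) : {poly {poly K}} := k%:P%:P.
pose x := pow_x m; pose M (a : 'I_m.+1) v := wmat h x pow_y m a v.
have wtE a u : (a <= m)%N -> size u = m ->
    wt (coef_list x pow_y a (m - a)) u = 'X^(wval u) * ('X^(wsum (take a u)))%:P.
  move=> am su; rewrite -{1}(cat_take_drop a u) wt_cat; last first.
    by rewrite size_mkseq size_takel ?su.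
  rewrite wt_pow_x ?size_takel ?su // wt_pow_y ?size_drop ?su // mulrAC subn0.
  have -> : wval u = (wval (take a u) * d ^ (m - a) + wval (drop a u))%N.
    by rewrite -{1}(cat_take_drop a u) wval_cat size_drop su.
  by rewrite -exprD.
apply: (minor_neq0 (P := fun v => red v /\ size v = m) (M := M)) => l l0.
apply: contrapT => /existsNP[a0 /eqP la0].
(* [H] is one more than the largest outer degree of the [l a], so the top coefficients sit at index
   [H.-1]. *)
pose H := \max_a size (l a).
have H0 : (0 < H)%N.
  by apply: leq_trans (leq_bigmax a0); rewrite size_poly_gt0.
pose mu a := (l (inord a))`_H.-1.
suff mu0 a : (a <= m)%N -> mu a = 0.
  have [a1 a1H] : exists a, size (l a) = H.
    have [|a Ha] := @bigop.eq_bigmax 'I_m.+1 (fun a => size (l a)); first by rewrite card_ord.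
    by exists a; rewrite /H Ha.
  have := mu0 a1; rewrite -ltnS ltn_ord => /(_ isT).
  rewrite /mu inord_val -a1H => /eqP; rewrite -[_`_ _]/(lead_coef _) lead_coef_eq0.
  by rewrite -size_poly_eq0 a1H -leqn0 leqNgt H0.
move: a; apply: branch_elim => v rv sv.
have := congr1 (fun p : {poly {poly K}} => p`_(H.-1 + wval v)) (l0 v (conj rv sv)).
rewrite coef0 coef_sum => E; rewrite -[RHS]E; apply: eq_bigr => a _.
rewrite /M /wmat mulr_sumr coef_sum (bigD1_seq v) ?words_uniq ?mem_words ?sv //=.
rewrite big1_seq => [|u /andP[uv]].
  rewrite addr0 wtE // -1?ltnS // g_diag // /h !polyC1 mulr1 mulrA coefMC.
  by rewrite coefMXn ltnNge leq_addl /= addnK /mu inord_val.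
rewrite mem_words => /eqP su; rewrite wtE // -1?ltnS // /h.
have [->|guv] := eqVneq (g u v) 0; first by rewrite !polyC0 !mulr0 coef0.
have [|vu|uvlt] := g_tri rv _ guv; first by rewrite su sv.
  by rewrite vu eqxx in uv.
rewrite !mulrA !coefMC coefMXn ifF; last first.
  by apply/negbTE; rewrite -leqNgt (leq_trans (ltnW uvlt)) ?leq_addl.
rewrite nth_default ?mul0r //.
apply: (@leq_trans H); first exact: leq_bigmax.
lia.
Qed.


(** The coefficients from [good_pow] depend on the length; they are specialized into K[z] and merged
    one length at a time. *)
Lemma ex_good M : exists x y : nat -> 'I_d -> {poly K},
  forall m, (m <= M)%N -> good polyC x y m.
Proof.
(* The powers of ['X] supply infinitely many values even when [K] is finite. *)
have e_inj : injective (fun n => 'X^n : {poly K}).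
  move=> i j /(congr1 (fun p : {poly K} => size p)).
  by rewrite !size_polyXn => -[].
suff [x [y xy]] : exists x y : nat -> 'I_d -> {poly K},
    forall m, m \in iota 0 M.+1 -> good polyC x y m.
  by exists x, y => m mM; apply: xy; rewrite mem_iota.
elim: (iota _ _) => [|m ms [x [y xy]]]; first by exists (fun _ _ => 0), (fun _ _ => 0).
have [k|t gt] := good_specialize (h := polyC) e_inj (ms := [:: m])
   (x := pow_x m) (y := pow_y).
  by rewrite inE => /eqP->; apply: good_pow.
have {}gt := gt m (mem_head _ _).
pose x' j c := (pow_x m j c).[t]; pose y' j c := (pow_y j c).[t].
(* The line through a parameter good for [ms] and one good for [m] has a point good for both. *)
have [k|t' gt'] := good_specialize (h := polyC) e_inj (ms := m :: ms)
   (x := fun j c => (x j c)%:P + (x' j c - x j c) *: 'X)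
   (y := fun j c => (y j c)%:P + (y' j c - y j c) *: 'X).
  rewrite inE => /predU1P[->|kms].
    by apply: (good_lift (t := 1) gt) => j c;
      rewrite hornerD hornerZ hornerX hornerC mulr1 addrC subrK.
  by apply: (good_lift (t := 0) (xy k kms)) => j c;
    rewrite hornerD hornerZ hornerX hornerC mulr0 addr0.
by eexists; eexists; apply: gt'.
Qed.

End Triangular.
End Gamma.
End Words.

(** * Left linear algebra over an Ore domain of scalars *)

Section LeftSpan.
Variables (R : nzRingType) (C : R -> Prop).

(** Scalars are a predicate on the ring, so the same lemmas serve [K] and [D] inside Q and K[z]
    inside Q[z]. *)
Inductive lspan (X : R -> Prop) : R -> Prop :=
| lspan0 : lspan X 0
| lspanS c x y : C c -> X x -> lspan X y -> lspan X (c * x + y).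

Definition lfree (I : finType) (F : I -> R) : Prop :=
  forall c : I -> R, (forall i, C (c i)) -> \sum_i c i * F i = 0 ->
  forall i, c i = 0.

Hypotheses (C1 : C 1) (CB : forall x y, C x -> C y -> C (x - y))
  (CM : forall x y, C x -> C y -> C (x * y)).

Lemma lscalar0 : C 0. Proof. by rewrite -(subrr 1); apply: CB. Qed.
Lemma lscalarN x : C x -> C (- x).
Proof. by move=> Cx; rewrite -sub0r; apply: CB => //; apply: lscalar0. Qed.
Lemma lscalarD x y : C x -> C y -> C (x + y).
Proof. by move=> Cx Cy; rewrite -[y]opprK; apply: CB => //; apply: lscalarN. Qed.
Lemma lscalar_sum (I : finType) (F : I -> R) : (forall i, C (F i)) -> C (\sum_i F i).
Proof. by move=> CF; elim/big_ind: _ => //; [apply: lscalar0|apply: lscalarD]. Qed.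

Lemma lspan_gen (X : R -> Prop) x : X x -> lspan X x.
Proof. by move=> Xx; rewrite -[x]mul1r -[_ * _]addr0; apply: lspanS => //; left. Qed.

Lemma lspanD X x y : lspan X x -> lspan X y -> lspan X (x + y).
Proof.
move=> Hx Hy; elim: Hx => [|c z t Cc Xz _ IH]; first by rewrite add0r.
by rewrite -addrA; apply: lspanS.
Qed.

Lemma lspanZ X c x : C c -> lspan X x -> lspan X (c * x).
Proof.
move=> Cc; elim=> [|b z t Cb Xz _ IH]; first by rewrite mulr0; left.
by rewrite mulrDr mulrA; apply: lspanS => //; apply: CM.
Qed.

Lemma lspanN X x : lspan X x -> lspan X (- x).
Proof. by move=> ?; rewrite -mulN1r; apply: lspanZ => //; apply: lscalarN. Qed.

Lemma lspan_sum X (I : finType) (P : pred I) (F : I -> R) :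
  (forall i, P i -> lspan X (F i)) -> lspan X (\sum_(i | P i) F i).
Proof. by move=> H; elim/big_ind: _ => //; [left|apply: lspanD]. Qed.

Lemma lspan_sum_seq X (T : eqType) (r : seq T) (P : pred T) (F : T -> R) :
  (forall i, i \in r -> P i -> lspan X (F i)) -> lspan X (\sum_(i <- r | P i) F i).
Proof.
move=> H; rewrite big_seq_cond; elim/big_ind: _ => //; first by left.
  exact: lspanD.
by move=> i /andP[]; apply: H.
Qed.

Lemma lspan_map (f : R -> R) (X Y : R -> Prop) x :
  f 0 = 0 -> (forall c y z, C c -> f (c * y + z) = c * f y + f z) ->
  (forall y, X y -> lspan Y (f y)) -> lspan X x -> lspan Y (f x).
Proof.
move=> f0 fL XY; elim=> [|c y z Cc Xy _ IH]; first by rewrite f0; left.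
by rewrite fL //; apply: lspanD => //; apply: lspanZ => //; apply: XY.
Qed.

Lemma lspan_sub (X Y : R -> Prop) x :
  (forall y, X y -> lspan Y y) -> lspan X x -> lspan Y x.
Proof. exact: (lspan_map (f := id)). Qed.

Lemma lspan_mulr (X Y : R -> Prop) x t :
  (forall y, X y -> lspan Y (y * t)) -> lspan X x -> lspan Y (x * t).
Proof.
by apply: (lspan_map (f := fun x => x * t)) => [|c y z _]; rewrite ?mul0r // mulrDl mulrA.
Qed.

Lemma lspan_mull (X Y : R -> Prop) x t : (forall c, C c -> t * c = c * t) ->
  (forall y, X y -> lspan Y (t * y)) -> lspan X x -> lspan Y (t * x).
Proof.
move=> tC; apply: (lspan_map (f := fun x => t * x)) => [|c y z Cc]; first by rewrite mulr0.
by rewrite mulrDr !mulrA tC.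
Qed.

Lemma lspan_seqP s x : lspan (fun y => y \in s) x <->
  exists2 c : 'I_(size s) -> R, forall i, C (c i) & x = \sum_i c i * s`_i.
Proof.
split=> [|[c Cc ->]]; last first.
  apply: lspan_sum => i _; apply: lspanZ => //; apply: lspan_gen.
  exact: mem_nth.
elim=> [|c y z Cc ys _ [b Cb ->]].
  exists (fun _ => 0) => [_|]; first exact: lscalar0.
  by rewrite big1 // => i _; rewrite mul0r.
have ys' : (index y s < size s)%N by rewrite index_mem.
exists (fun i => (if i == Ordinal ys' then c else 0) + b i) => [i|].
  by apply: lscalarD => //; case: eqP => // _; apply: lscalar0.
under [RHS]eq_bigr do rewrite mulrDl.
rewrite big_split /=; congr (_ + _).
rewrite (bigD1 (Ordinal ys')) //= eqxx nth_index // big1 ?addr0 // => i /negbTE->.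
by rewrite mul0r.
Qed.

Section Ore.
Hypothesis Cdom : forall x y, C x -> C y -> x * y = 0 -> x = 0 \/ y = 0.
Hypothesis Core : forall x y, C x -> C y -> y != 0 ->
  exists u v, [/\ C u, C v, u != 0 & u * x = v * y].

(** Fraction-free elimination: the Ore condition supplies left multipliers that cancel column [n] of
    every other row against a pivot row, which leaves one row and one column fewer. *)
Lemma ldep_ord n N (a : 'I_N -> nat -> R) : (n < N)%N -> (forall i j, C (a i j)) ->
  exists c : 'I_N -> R, [/\ forall i, C (c i), exists i, c i != 0 &
    forall j, (j < n)%N -> \sum_i c i * a i j = 0].
Proof.
elim: n N a => [|n IH] [|N] // a nN Ca.
  exists (fun _ => 1); split=> //.
  by exists ord0; rewrite oner_neq0.
have [[i0 ai0]|a0] := pselect (exists i, a i n != 0); last first.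
  have [c [Cc c0 cE]] := IH N.+1 a (ltnW nN) Ca; exists c; split=> // j.
  rewrite ltnS leq_eqVlt => /predU1P[->|]; last exact: cE.
  rewrite big1 // => i _; suff -> : a i n = 0 by rewrite mulr0.
  by apply/eqP/negPn/negP => ain; apply: a0; exists i.
have [u uP] := choice (fun i => Core (Ca i n) (Ca i0 n) ai0).
have [v uv] := choice uP.
have [] := IH N (fun i j => u (lift i0 i) * a (lift i0 i) j - v (lift i0 i) * a i0 j).
- by [].
- by move=> i j; have [Cu Cv _ _] := uv (lift i0 i); apply: CB; apply: CM.
move=> c [Cc [k ck] cE].
(* The relation pulled back to the original rows; the pivot row receives minus the sum of the
   multiples subtracted. *)
pose c' i := if unlift i0 i is Some k then c k * u i
             else - \sum_k c k * v (lift i0 k).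
have c'E k' : c' (lift i0 k') = c k' * u (lift i0 k') by rewrite /c' liftK.
exists c'; split=> [i||j].
- rewrite /c'; case: unliftP => [k' _|_]; first by have [Cu _ _ _] := uv i; apply: CM.
  apply: lscalarN; apply: lscalar_sum => k'.
  by have [_ Cv _ _] := uv (lift i0 k'); apply: CM.
- exists (lift i0 k); rewrite c'E; apply/eqP => /Cdom.
  have [Cu _ u0 _] := uv (lift i0 k).
  by move=> /(_ (Cc k) Cu)[] /eqP; apply/negP.
rewrite ltnS leq_eqVlt => jn; rewrite (bigD1_ord i0) //= {1}/c' unlift_none.
under eq_bigr do rewrite c'E.
rewrite mulNr mulr_suml -sumrN -big_split /=.
have E k' : - (c k' * v (lift i0 k') * a i0 j) + c k' * u (lift i0 k') * a (lift i0 k') j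
   = c k' * (u (lift i0 k') * a (lift i0 k') j - v (lift i0 k') * a i0 j).
  by rewrite mulrBr !mulrA addrC.
under eq_bigr do rewrite E.
case/predU1P: jn => [->|]; last exact: cE.
rewrite big1 // => k' _; have [_ _ _ ->] := uv (lift i0 k').
by rewrite subrr mulr0.
Qed.

Lemma ldep (I J : finType) (a : I -> J -> R) : (#|J| < #|I|)%N ->
  (forall i j, C (a i j)) ->
  exists c : I -> R, [/\ forall i, C (c i), exists i, c i != 0 &
    forall j, \sum_i c i * a i j = 0].
Proof.
move=> JI Ca.
pose b (i : 'I_#|I|) k := if insub k is Some k' then a (enum_val i) (enum_val (k' : 'I_#|J|)) else 0.
have [|c [Cc [i ci] cE]] := ldep_ord (a := b) JI.
  by move=> i k; rewrite /b; case: insubP => // _; apply: lscalar0.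
exists (fun i => c (enum_rank i)); split=> // [|j].
  by exists (enum_val i); rewrite enum_valK.
rewrite -[RHS](cE (enum_rank j) (ltn_ord _)).
rewrite (reindex (@enum_val I I)) /=; last first.
  exact: (onW_bij _ (@enum_val_bij I)).
by apply: eq_bigr => k _; rewrite enum_valK /b valK enum_rankK.
Qed.

Lemma lfree_size (I : finType) (F : I -> R) (s : seq R) :
  lfree F -> (forall i, lspan (fun y => y \in s) (F i)) -> (#|I| <= size s)%N.
Proof.
move=> Ffree Fs; rewrite leqNgt; apply/negP => sI.
have {}Fs i : exists c : 'I_(size s) -> R, (forall j, C (c j)) /\ F i = \sum_j c j * s`_j.
  by have /lspan_seqP[c ? ?] := Fs i; exists c.
have [a aP] := choice Fs.
have [||c [Cc [i ci] cE]] := @ldep I 'I_(size s) a.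
- by rewrite card_ord.
- by move=> i j; have [] := aP i.
move/negP: ci; apply; apply/eqP; apply: Ffree => //.
under eq_bigr => k _ do rewrite (aP k).2 mulr_sumr.
rewrite exchange_big big1 // => j _.
under eq_bigr do rewrite mulrA.
by rewrite -mulr_suml cE mul0r.
Qed.

End Ore.

Section Division.
Hypothesis Cinv : forall x, C x -> x != 0 -> exists2 y, C y & y * x = 1.

Lemma division_dom x y : C x -> C y -> x * y = 0 -> x = 0 \/ y = 0.
Proof.
move=> Cx Cy xy; have [->|/(Cinv Cx)[z _ zx]] := eqVneq x 0; first by left.
by right; rewrite -[y]mul1r -zx -mulrA xy mulr0.
Qed.

Lemma division_ore x y : C x -> C y -> y != 0 ->
  exists u v, [/\ C u, C v, u != 0 & u * x = v * y].
Proof.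
move=> Cx Cy /(Cinv Cy)[z Cz zy]; exists 1, (x * z).
by split; rewrite ?oner_neq0 // ?mul1r -?mulrA ?zy ?mulr1 //; apply: CM.
Qed.

Definition lfree_seq (s : seq R) := lfree (fun i : 'I_(size s) => s`_i).

Lemma lfree_rcons s x : lfree_seq s -> ~ lspan (fun y => y \in s) x ->
  lfree_seq (rcons s x).
Proof.
move=> sfree sx c; move: (c) => {c}; rewrite /lfree_seq size_rcons => c Cc.
rewrite big_ord_recr /= nth_rcons ltnn eqxx.
under eq_bigr do rewrite nth_rcons ltn_ord.
move=> E.
have cn : c ord_max = 0.
  apply: contrapT => /eqP cn; have [z Cz zc] := Cinv (Cc _) cn.
  apply: sx; rewrite -[x]mul1r -zc -mulrA.
  apply: lspanZ => //.
  move/eqP: E; rewrite addrC addr_eq0 => /eqP->; apply: lspanN.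
  apply: lspan_sum => i _; apply: lspanZ => //; apply: lspan_gen.
  exact: mem_nth.
rewrite cn mul0r addr0 in E.
have /(_ E) H := sfree (fun i => c (widen_ord (leqnSn _) i)) (fun i => Cc _).
move=> i; case: (unliftP ord_max i) => [j ->|->] //.
by rewrite -[RHS](H j); congr (c _); apply: val_inj; rewrite /= /bump leqNgt ltn_ord.
Qed.

Lemma lfree_extend s g : lfree_seq s ->
  exists b : bitseq, [/\ size b = size g, lfree_seq (s ++ mask b g) &
    forall x, x \in g -> lspan (fun y => y \in s ++ mask b g) x].
Proof.
elim: g s => [|x g IH] s sfree; first by exists [::]; rewrite cats0.
have [sx|sx] := pselect (lspan (fun y => y \in s) x).
  have [b [sb bf bs]] := IH s sfree; exists (false :: b); split=> //=.
    by rewrite sb.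
  move=> y; rewrite inE => /predU1P[->|]; last exact: bs.
  by apply: lspan_sub sx => z zs; apply: lspan_gen; rewrite mem_cat zs.
have [b [sb bf bs]] := IH _ (lfree_rcons sfree sx); exists (true :: b).
rewrite /= sb -cat_rcons; split=> //.
move=> y; rewrite inE => /predU1P[->|]; last exact: bs.
by apply: lspan_gen; rewrite mem_cat mem_rcons mem_head.
Qed.

End Division.
End LeftSpan.

(** * Reduced words *)

Section Scalars.
Variables (K : fieldType) (Q : unitAlgType K).

Definition kscalar (x : Q) := exists k : K, x = k%:A.

Lemma kscalar1 : kscalar 1. Proof. by exists 1; rewrite scale1r. Qed.
Lemma kscalarB x y : kscalar x -> kscalar y -> kscalar (x - y).
Proof. by move=> [a ->] [b ->]; exists (a - b); rewrite scalerBl. Qed.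
Lemma kscalarM x y : kscalar x -> kscalar y -> kscalar (x * y).
Proof. by move=> [a ->] [b ->]; exists (a * b); rewrite mulr_algl scalerA. Qed.
Lemma kscalarC x t : kscalar x -> t * x = x * t.
Proof. by move=> [a ->]; rewrite mulr_algl mulr_algr. Qed.
Lemma kscalarV x : kscalar x -> x != 0 -> exists2 y, kscalar y & y * x = 1.
Proof.
move=> [a ->] a0; exists (a^-1)%:A; first by exists a^-1.
rewrite mulr_algl scalerA mulVf ?scale1r //.
by apply: contra a0 => /eqP->; rewrite scale0r.
Qed.

Notation kspan s := (lspan kscalar (fun y => y \in s)).
Notation kfree := (lfree_seq kscalar).

Lemma kscalar_fun (I : Type) (c : I -> Q) : (forall i, kscalar (c i)) ->
  exists k : I -> K, c = fun i => (k i)%:A.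
Proof. by move=> /choice[k kE]; exists k; apply/funext. Qed.

Lemma in_spanP ws (x : Q) : in_span ws x <-> kspan ws x.
Proof.
rewrite (lspan_seqP kscalar1 kscalarB kscalarM); split=> [[c ->]|[c Cc ->]].
  by exists (fun i => (c i)%:A) => [i|]; [exists (c i)|apply: eq_bigr => i _; rewrite mulr_algl].
have [k ->] := kscalar_fun Cc; exists k.
by apply: eq_bigr => i _; rewrite mulr_algl.
Qed.

Lemma lin_indepP (vs : seq Q) : lin_indep vs <-> kfree vs.
Proof.
split=> H => [c Cc|c E i].
  have [k ->] := kscalar_fun Cc => E i.
  rewrite (H k) ?scale0r // -[RHS]E.
  by apply: eq_bigr => j _; rewrite mulr_algl.
have /(_ _ i) Hi := H (fun i => (c i)%:A) (fun i => ex_intro _ (c i) erefl).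
have /eqP : (c i)%:A = 0 :> Q.
  by apply: Hi; rewrite -[RHS]E; apply: eq_bigr => j _; rewrite mulr_algl.
by rewrite scaler_eq0 oner_eq0 orbF => /eqP.
Qed.

Lemma kfree_size (I : finType) (F : I -> Q) (s : seq Q) :
  lfree kscalar F -> (forall i, kspan s (F i)) -> (#|I| <= size s)%N.
Proof.
apply: (lfree_size kscalar1 kscalarB kscalarM).
  by apply: division_dom; apply: kscalarV.
by apply: division_ore => //; [exact: kscalar1|exact: kscalarM|exact: kscalarV].
Qed.

Lemma kfree_extend (s g : seq Q) : kfree s ->
  exists b : bitseq, [/\ size b = size g, kfree (s ++ mask b g) &
    forall x, x \in g -> kspan (s ++ mask b g) x].
Proof.
by apply: lfree_extend;
  [exact: kscalar1|exact: kscalarB|exact: kscalarM|exact: kscalarV].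
Qed.

(** A greedily chosen free subfamily spans, so by exchange it attains the maximum in [dimspan]. *)
Lemma dimspan_basis (ws : seq Q) : exists e : seq Q,
  [/\ kfree e, size e = dimspan ws, {subset e <= ws} & forall x, x \in ws -> kspan e x].
Proof.
have nilfree : kfree ([::] : seq Q) by move=> c _ _ [].
have [b [sb bfree bspan]] := kfree_extend ws nilfree.
rewrite /= in bfree bspan; exists (mask b ws); split=> //; last first.
  by move=> x; apply: mem_mask.
apply/eqP; rewrite eqn_leq; apply/andP; split.
  have sb' : size b == size ws by rewrite sb.
  apply: (@leq_bigmax_cond _ _ (fun b : (size ws).-tuple bool => size (mask b ws)) (Tuple sb')).
  by apply/asboolP/lin_indepP.
apply/bigmax_leqP => b' /asboolP/lin_indepP bfree'.
rewrite -[size (mask b' _)]card_ord; apply: (kfree_size bfree') => i.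
by apply: bspan; apply: (@mem_mask _ _ b'); apply: mem_nth.
Qed.

Lemma leq_dimspan (I : finType) (F : I -> Q) (ws : seq Q) :
  lfree kscalar F -> (forall i, kspan ws (F i)) -> (#|I| <= dimspan ws)%N.
Proof.
move=> Ffree Fws; have [e [efree <- _ ews]] := dimspan_basis ws.
apply: (kfree_size Ffree) => i.
exact: (lspan_sub kscalarM ews (Fws i)).
Qed.

Lemma dimspan_leq (ws vs : seq Q) :
  (forall x, x \in ws -> kspan vs x) -> (dimspan ws <= size vs)%N.
Proof.
move=> wsvs; have [e [efree <- ews _]] := dimspan_basis ws.
rewrite -[size e]card_ord; apply: (kfree_size efree) => i.
by apply/wsvs/ews/mem_nth.
Qed.

End Scalars.
Local Notation kspan s := (lspan (@kscalar _ _) (fun y => y \in s)).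
Local Notation kfree := (lfree_seq (@kscalar _ _)).

Section Reduced.
Variables (K : fieldType) (Q : unitAlgType K) (d : nat) (w : 'I_d -> Q).
Implicit Types u v : seq 'I_d.
Notation kscalar := (@kscalar K Q).

Definition wordp u : Q := \prod_(x <- u) w x.

Lemma wordp_cat u v : wordp (u ++ v) = wordp u * wordp v.
Proof. exact: big_cat. Qed.

Definition low m (y : Q) := exists2 v, (size v < m)%N & y = wordp v.
Definition above u (y : Q) :=
  exists2 v, size v = size u /\ (wval u < wval v)%N & y = wordp v.
Definition reduced u := ~ lspan kscalar (fun y => above u y \/ low (size u) y) (wordp u).

Let k1 := @kscalar1 K Q.
Let kB := @kscalarB K Q.
Let kM := @kscalarM K Q.

(** Multiplying by [u1] on the left and [u3] on the right preserves comparisons of length and of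
    lexicographic order, so a relation for [u2] would give one for the whole word. *)
Lemma reduced_factor u1 u2 u3 : reduced (u1 ++ u2 ++ u3) -> reduced u2.
Proof.
move=> r u2s; apply: r; rewrite !wordp_cat mulrA.
move: u2s; apply: (lspan_map kM (f := fun t => wordp u1 * t * wordp u3)).
- by rewrite mulr0 mul0r.
- by move=> c y z Cc; rewrite mulrDr mulrDl !mulrA (kscalarC (wordp u1) Cc).
move=> _ [[v [sv uv] ->]|[v sv ->]]; apply: (lspan_gen k1); [left|right].
  exists (u1 ++ v ++ u3); last by rewrite !wordp_cat mulrA.
  rewrite !size_cat sv; split=> //.
  rewrite !wval_cat !size_cat sv ltn_add2l ltn_add2r ltn_pmul2r //.
  by apply: leq_ltn_trans (wval_lt u3).
exists (u1 ++ v ++ u3); last by rewrite !wordp_cat mulrA.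
by rewrite !size_cat ltn_add2l ltn_add2r.
Qed.

(** The bound [k] keeps the normal form triangular: that of a word which is not reduced will involve
    only larger words. *)
Definition normal m k (y : Q) := exists2 g : seq 'I_d -> K,
  forall v, g v != 0 -> [/\ size v = m, reduced v & (k <= wval v)%N] &
  lspan kscalar (low m) (y - \sum_(v <- words d m) g v *: wordp v).

Lemma normal_low m k y : lspan kscalar (low m) y -> normal m k y.
Proof.
move=> ly; exists (fun _ => 0) => [v|]; first by rewrite eqxx.
by rewrite big1 ?subr0 // => v _; rewrite scale0r.
Qed.

Lemma normal_span m k (X : Q -> Prop) y :
  (forall z, X z -> normal m k z) -> lspan kscalar X y -> normal m k y.
Proof.
move=> Xn; elim=> [|_ z t [c ->] Xz _ [g1 g1P g1E]]; first by apply: normal_low; left.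
have [g2 g2P g2E] := Xn z Xz.
exists (fun v => c * g2 v + g1 v) => [v cv|].
  have [g20|g20] := eqVneq (g2 v) 0; last exact: g2P.
  by apply: g1P; apply: contra cv => /eqP->; rewrite g20 mulr0 addr0.
under eq_bigr do rewrite scalerDl -scalerA.
rewrite big_split /= -scaler_sumr opprD addrACA.
apply: lspanD => //; rewrite mulr_algl -scalerBr -mulr_algl.
by apply: (lspanZ kM) => //; exists c.
Qed.

Lemma normal_wordp m v k : size v = m -> reduced v -> (k <= wval v)%N ->
  normal m k (wordp v).
Proof.
move=> sv rv kv; exists (fun u => (u == v)%:R) => [u|].
  by have [->|_] := eqVneq u v; rewrite ?eqxx.
rewrite (bigD1_seq v) ?words_uniq ?mem_words ?sv //= eqxx scale1r big1 => [|u /negbTE->].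
  by rewrite addr0 subrr; left.
by rewrite scale0r.
Qed.

(** Induction downwards in lexicographic order: the word is a combination of shorter words and of
    larger words, which are reduced or already have normal forms. *)
Lemma normal_exists m u : size u = m -> ~ reduced u -> normal m (wval u).+1 (wordp u).
Proof.
suff H n v : (d ^ m - wval v <= n)%N -> size v = m -> ~ reduced v ->
    normal m (wval v).+1 (wordp v) by apply: (H _ u (leqnn _)).
elim: n v => {u} [|n IH] u un su.
  by move: un; rewrite leqn0 subn_eq0 leqNgt -su wval_lt.
move=> /contrapT; apply: normal_span => z [[v [sv uv] ->]|].
  rewrite su in sv; have [rv|nrv] := pselect (reduced v).
    exact: normal_wordp.
  have [|g gP gE] := IH v _ sv nrv; first by lia.
  exists g => // t /gP[? ? vt]; split=> //.
  exact: ltn_trans vt.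
move=> [v vu ->]; apply: normal_low; apply: (lspan_gen k1).
by exists v => //; rewrite -su.
Qed.

Lemma ex_normal_form : exists g : seq 'I_d -> seq 'I_d -> K,
  [/\ forall v, reduced v -> g v v = 1,
   forall u v, g u v != 0 ->
     [/\ size v = size u, reduced v & u = v \/ (wval u < wval v)%N] &
   forall u, lspan kscalar (low (size u))
     (wordp u - \sum_(v <- words d (size u)) g u v *: wordp v)].
Proof.
suff /choice[g gP] : forall u, exists g : seq 'I_d -> K,
  [/\ reduced u -> g u = 1, forall v, g v != 0 ->
     [/\ size v = size u, reduced v & u = v \/ (wval u < wval v)%N] &
    lspan kscalar (low (size u))
     (wordp u - \sum_(v <- words d (size u)) g v *: wordp v)].
  exists g; split=> [v|u v|u]; first by have [] := gP v.
    by have [_ + _] := gP u; apply.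
  by have [] := gP u.
move=> u; have [ru|nru] := pselect (reduced u).
  exists (fun v => (v == u)%:R); split=> [_|v|]; first by rewrite eqxx.
    have [->|_] := eqVneq v u; last by rewrite eqxx.
    by split=> //; left.
  rewrite (bigD1_seq u) ?words_uniq ?mem_words //= eqxx scale1r big1 => [|v /negbTE->].
    by rewrite addr0 subrr; left.
  by rewrite scale0r.
have [g gP gE] := normal_exists erefl nru; exists g; split=> // v /gP[? ? ?].
by split=> //; right.
Qed.

(** Solving a nontrivial relation for its lexicographically least word would show that this word is
    not reduced. *)
Lemma reduced_free m (c : seq 'I_d -> K) :
  (forall v, c v != 0 -> size v = m -> reduced v) ->
  lspan kscalar (low m) (\sum_(v <- words d m) c v *: wordp v) ->
  forall v, size v = m -> c v = 0.
Proof.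
move=> cr clow v sv; apply: contrapT => /eqP cv.
have ex : exists n, `[< exists t, [/\ size t = m, c t != 0 & wval t = n] >].
  by exists (wval v); apply/asboolP; exists v.
have := ex_minnP ex => -[n /asboolP[t [st ct tn]] nmin].
apply: (cr t ct st).
have tw : t \in words d m by rewrite mem_words st.
rewrite (bigD1_seq t) ?words_uniq //= in clow.
set S := \sum_(_ <- _ | _) _ in clow.
have -> : wordp t = (c t)^-1 *: ((c t *: wordp t + S) - S).
  by rewrite addrK scalerA mulVf // scale1r.
rewrite -mulr_algl; apply: (lspanZ kM); first by exists (c t)^-1.
apply: lspanD.
  apply: (lspan_sub kM) clow => y yl; apply: (lspan_gen k1).
  by right; rewrite st.
apply: (lspanN k1 kB kM); apply: lspan_sum_seq => u.
rewrite mem_words => /eqP su ut.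
have [->|cu] := eqVneq (c u) 0; first by rewrite scale0r; left.
rewrite -mulr_algl; apply: (lspanZ kM); first by exists (c u).
apply: (lspan_gen k1); left; exists u => //; split; first by rewrite su.
have := nmin (wval u); rewrite tn ltn_neqAle => -> //; last first.
  by apply/asboolP; exists u.
rewrite andbT -tn; apply: contra ut => /eqP ut; apply/eqP.
by apply: wval_inj => //; rewrite su.
Qed.

End Reduced.

(** * Branching of reduced words and independent products *)

Section Branching.
Variables (K : fieldType) (Q : unitAlgType K) (d : nat) (w : 'I_d -> Q).
Hypothesis d_gt0 : (0 < d)%N.
Implicit Types u v : seq 'I_d.

Let k1 := @kscalar1 K Q.
Let kM := @kscalarM K Q.

Definition reduced_words m := [seq u <- words d m | `[< reduced w u >]].
Definition reduced_values m := flatten [seq map (wordp w) (reduced_words k) | k <- iota 0 m].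

Lemma mem_reduced_words m u :
  reflect (size u = m /\ reduced w u) (u \in reduced_words m).
Proof.
rewrite mem_filter mem_words; apply: (iffP andP) => [[/asboolP ? /eqP ?]|[? ?]] //.
by split; [apply/asboolP|apply/eqP].
Qed.

Lemma mem_reduced_values m u : (size u < m)%N -> reduced w u ->
  wordp w u \in reduced_values m.
Proof.
move=> um ru; apply/flatten_mapP; exists (size u); first by rewrite mem_iota.
by apply: map_f; apply/mem_reduced_words.
Qed.

(** Induction on the length: modulo shorter words, a word equals a combination of reduced words of
    its own length. *)
Lemma low_span m y : low w m y -> kspan (reduced_values m) y.
Proof.
elim: m y => [|m IH] y [v vm yE]; first by [].
have IH' z : lspan (@kscalar K Q) (low w m) z -> kspan (reduced_values m.+1) z.
  apply: (lspan_sub kM) => t /IH; apply: (lspan_sub kM) => s sm.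
  apply: (lspan_gen k1); move: sm => /flatten_mapP[k km sk].
  apply/flatten_mapP; exists k => //.
  by move: km; rewrite !mem_iota /= => /ltn_trans; apply.
move: vm; rewrite ltnS leq_eqVlt => /predU1P[vm|vm]; last first.
  by apply: IH'; apply: (lspan_gen k1); exists v.
have [g [_ g2 g3]] := ex_normal_form w.
rewrite yE -(subrK (\sum_(u <- words d (size v)) g v u *: wordp w u) (wordp w v)).
apply: lspanD; first by apply: IH'; rewrite -vm; apply: g3.
apply: lspan_sum_seq => u; rewrite mem_words => /eqP su _.
have [->|gvu] := eqVneq (g v u) 0; first by rewrite scale0r; left.
have [_ ru _] := g2 _ _ gvu.
rewrite -mulr_algl; apply: (lspanZ kM); first by exists (g v u).
by apply: (lspan_gen k1); apply: mem_reduced_values; rewrite // su vm.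
Qed.

Lemma dimspan_words m c : (forall k, size (reduced_words k) <= c)%N ->
  (dimspan [seq wordp w u | u <- words d m] <= c * m.+1)%N.
Proof.
move=> rc; apply: (@leq_trans (size (reduced_values m.+1))).
  apply: dimspan_leq => y /mapP[u]; rewrite mem_words => /eqP su ->.
  by apply: low_span; exists u => //; rewrite su.
rewrite /reduced_values -{2}(size_iota 0 m.+1).
elim: (iota _ _) => //= k s IH.
by rewrite size_cat size_map mulnS leq_add.
Qed.

(** Without branching at position [j], a letter that stands at position [j] of a factor of length
    [m0] is determined by the [j] letters before it, so only the first [j] and the last [m0 - j.+1]
    letters are free. *)
Lemma size_reduced_words m0 j : (j < m0)%N ->
  (forall v v', reduced w v -> reduced w v' -> size v = m0 -> size v' = m0 ->
     take j v = take j v' -> wsum (take j.+1 v) = wsum (take j.+1 v')) ->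
  forall m, (size (reduced_words m) <= d ^ m0)%N.
Proof.
move=> jm0 nobranch m; have [mm0|m0m] := ltnP m m0.
  apply: (@leq_trans (d ^ m)%N); last by rewrite leq_pexp2l // ltnW.
  by rewrite -size_words size_filter count_size.
pose f u := (take j u, drop (m - (m0 - j.+1)) u).
have f_inj : {in reduced_words m &, injective f}.
  move=> u u' /mem_reduced_words[su ru] /mem_reduced_words[su' ru'] [Et Ed].
  have x0 : 'I_d by exact: (Ordinal d_gt0).
  apply: (@eq_from_nth _ x0); first by rewrite su su'.
  move=> i; rewrite su; have [n] := ubnP i; elim: n i => // n IH i /ltnSE ile im.
  have [ij|ji] := ltnP i j.
    by rewrite -(nth_take x0 ij u) Et nth_take.
  have [hi|lo] := leqP (m - (m0 - j.+1)) i.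
    by rewrite -(subnKC hi) -!nth_drop Ed.
  (* The factor of length [m0] in which the letter at index [i] of the whole word has position
     [j]. *)
  pose fac (t : seq 'I_d) := take m0 (drop (i - j) t).
  have fac_red t : reduced w t -> reduced w (fac t).
    rewrite -{1}(cat_take_drop (i - j) t) -{1}(cat_take_drop m0 (drop _ t)).
    exact: reduced_factor.
  have fac_size t : size t = m -> size (fac t) = m0.
    by move=> st; rewrite size_takel // size_drop st; lia.
  have fac_nth t k : (k < m0)%N -> nth x0 (fac t) k = nth x0 t (i - j + k).
    by move=> km; rewrite nth_take // nth_drop.
  have Ej : take j (fac u) = take j (fac u').
    have st t : size t = m -> size (take j (fac t)) = j.
      by move=> ?; rewrite size_take fac_size // jm0.
    apply: (@eq_from_nth _ x0); first by rewrite !st.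
    move=> k; rewrite st // => kj; rewrite [LHS]nth_take // [RHS]nth_take // !fac_nth ?(ltn_trans kj) //.
    by apply: IH; lia.
  have := nobranch _ _ (fac_red _ ru) (fac_red _ ru') (fac_size _ su) (fac_size _ su') Ej.
  rewrite !(take_nth x0) ?fac_size // Ej /wsum !map_rcons !sumn_rcons.
  by move=> /addnI/val_inj; rewrite !fac_nth // subnK.
rewrite -(size_map f); apply: (@leq_trans (size
   [seq (u, v) | u <- words d j, v <- words d (m0 - j.+1)])); last first.
  by rewrite size_allpairs !size_words -expnD leq_pexp2l //; lia.
apply: uniq_leq_size.
  by rewrite map_inj_in_uniq // filter_uniq // words_uniq.
move=> _ /mapP[u /mem_reduced_words[su _] ->]; apply/allpairsP.
exists (f u); split=> //=; rewrite mem_words.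
  by rewrite size_takel // su (leq_trans _ m0m) // ltnW.
by rewrite size_drop su; apply/eqP; lia.
Qed.

(** Otherwise [size_reduced_words] bounds the number of reduced words of each length by a constant,
    and [dimspan_words] makes the growth at most linear. *)
Lemma reduced_branch :
  (forall c, exists m, (c * m.+1 < dimspan [seq wordp w u | u <- words d m])%N) ->
  forall m j, (j < m)%N -> exists v v',
  [/\ reduced w v, reduced w v', size v = m, size v' = m &
      take j v = take j v' /\ wsum (take j.+1 v) <> wsum (take j.+1 v')].
Proof.
move=> superlin m j jm; apply: contrapT => nb.
have [k] := superlin (d ^ m)%N; apply/negP; rewrite -leqNgt.
apply/dimspan_words/(size_reduced_words jm) => v v' rv rv' sv sv' E.
by apply: contrapT => N; apply: nb; exists v, v'.
Qed.

Lemma reduced_nil : reduced w [::].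
Proof.
suff H y : lspan (@kscalar K Q) (fun y => above w [::] y \/ low w 0 y) y -> y = 0.
  by move/H/eqP; rewrite /wordp big_nil oner_eq0.
elim=> // c x z _ [[[|? ?] [// _] //]|[]//].
Qed.

End Branching.

(** * Independence of the path products *)

Section Trees.
Variables (K : fieldType) (Q : unitAlgType K) (d : nat) (w : 'I_d -> Q).
Implicit Types u v : seq 'I_d.

(** The embedding of K[z] in Q[z]; its central image serves as the scalars below. *)
Definition liftp : {poly K} -> {poly Q} := map_poly (in_alg Q).
HB.instance Definition _ := GRing.RMorphism.copy liftp (map_poly (in_alg Q)).

Lemma liftp_central p (q : {poly Q}) : q * liftp p = liftp p * q.
Proof.
apply/polyP => i; rewrite coefM coefMr; apply: eq_bigr => j _.
by rewrite !coef_map /= mulr_algr mulr_algl.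
Qed.

Lemma coef_liftpC p (q : Q) k : (liftp p * q%:P)`_k = p`_k *: q.
Proof. by rewrite coefMC coef_map /= mulr_algl. Qed.

Definition letter_comb (c : 'I_d -> {poly K}) : {poly Q} :=
  \sum_x liftp (c x) * (w x)%:P.

Lemma prod_letter_comb cs : \prod_(c <- cs) letter_comb c =
  \sum_(u <- words d (size cs)) liftp (wt cs u) * (wordp w u)%:P.
Proof.
elim: cs => [|c cs IH].
  by rewrite big_nil /= big_seq1 rmorph1 /wordp big_nil mulr1.
rewrite big_cons IH /= [size _]/= big_words mulr_suml; apply: eq_bigr => x _.
rewrite mulr_sumr; apply: eq_bigr => u _ /=.
rewrite rmorphM -!mulrA; congr (_ * _).
by rewrite mulrA liftp_central -mulrA /wordp big_cons rmorphM.
Qed.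

(** Products of different total length are separated by working modulo shorter words, those of the
    same length by the nonzero minor in [good]. Total lengths stay below [r + r]. *)
Lemma tree_free (x y : nat -> 'I_d -> {poly K}) g r :
  (forall v, reduced w v -> g v v = 1) ->
  (forall u v, g u v != 0 ->
     [/\ size v = size u, reduced w v & u = v \/ (wval u < wval v)%N]) ->
  (forall u, lspan (@kscalar K Q) (low w (size u))
     (wordp w u - \sum_(v <- words d (size u)) g u v *: wordp w v)) ->
  (forall m, (m <= r + r)%N -> good g polyC x y m) ->
  forall l : 'I_r * 'I_r -> {poly K},
  \sum_p liftp (l p) * \prod_(c <- coef_list x y p.1 p.2) letter_comb c = 0 ->
  forall p, l p = 0.
Proof.
move=> g1 g2 g3 xy l l0 p0; apply: contrapT => /eqP lp0.
(* Look at the terms of maximal total length in a relation, modulo shorter words. *)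
pose deg (p : 'I_r * 'I_r) := (p.1 + p.2)%N.
have [p1 lp1 pmax] : exists2 p, l p != 0 & forall q, l q != 0 -> (deg q <= deg p)%N.
  by case: (arg_maxnP deg (P := fun p => l p != 0) lp0) => p ? ?; exists p.
pose m := deg p1.
have mr : (m <= r + r)%N by rewrite leq_add // ltnW.
(* The coefficient of z^k at the word [u] in the part of the relation of total length [m]. *)
pose S k u : K := \sum_(p | deg p == m) (l p * wt (coef_list x y p.1 p.2) u)`_k.
have Slow k : lspan (@kscalar K Q) (low w m) (\sum_(u <- words d m) S k u *: wordp w u).
  have -> : \sum_(u <- words d m) S k u *: wordp w u =
     - \sum_(p | deg p != m) \sum_(u <- words d (deg p))
         (l p * wt (coef_list x y p.1 p.2) u)`_k *: wordp w u.
    apply/eqP; rewrite -addr_eq0; apply/eqP.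
    have := congr1 (fun p : {poly Q} => p`_k) l0; rewrite coef0 coef_sum => H; rewrite -[RHS]H.
    rewrite [RHS](bigID (fun p => deg p == m)) /=.
    have E p : (liftp (l p) * \prod_(c <- coef_list x y p.1 p.2) letter_comb c)`_k
       = \sum_(u <- words d (deg p)) (l p * wt (coef_list x y p.1 p.2) u)`_k *: wordp w u.
      rewrite prod_letter_comb size_coef_list mulr_sumr coef_sum.
      by apply: eq_bigr => u _; rewrite mulrA -rmorphM coef_liftpC.
    congr (_ + _); last by apply: eq_bigr => p _; rewrite E.
    under eq_bigr do rewrite /S scaler_suml.
    rewrite exchange_big /=; apply: eq_bigr => p /eqP pm.
    by rewrite E pm.
  apply: (lspanN (@kscalar1 K Q) (@kscalarB K Q) (@kscalarM K Q)).
  apply: lspan_sum => p pm; apply: lspan_sum_seq => u; rewrite mem_words => /eqP su _.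
  have [lp|lp] := eqVneq (l p) 0; first by rewrite lp mul0r coef0 scale0r; left.
  rewrite -mulr_algl; apply: (lspanZ (@kscalarM K Q)).
    by exists (l p * wt (coef_list x y p.1 p.2) u)`_k.
  apply: (lspan_gen (@kscalar1 K Q)); exists u => //.
  by rewrite su ltn_neqAle pm pmax.
(* Replacing words by their normal forms gives a relation among reduced words of length [m], whose
   coefficients must vanish. *)
have S0 k v : size v = m -> \sum_(u <- words d m) S k u * g u v = 0.
  move: v; apply: (@reduced_free _ _ _ w) => [v nz _|].
    apply: contrapT => nr; move/negP: nz; apply; apply/eqP; apply: big1 => u _.
    have [->|/g2[]//] := eqVneq (g u v) 0; by rewrite mulr0.
  have -> : \sum_(v <- words d m) (\sum_(u <- words d m) S k u * g u v) *: wordp w v =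
    \sum_(u <- words d m) S k u *: wordp w u -
    \sum_(u <- words d m) S k u *: (wordp w u - \sum_(v <- words d m) g u v *: wordp w v).
    rewrite -sumrB; under [RHS]eq_bigr do rewrite scalerBr opprB addrC subrK scaler_sumr.
    rewrite exchange_big /=; apply: eq_bigr => v _.
    by rewrite scaler_suml; apply: eq_bigr => u _; rewrite scalerA.
  apply: lspanD => //.
  apply: (lspanN (@kscalar1 K Q) (@kscalarB K Q) (@kscalarM K Q)).
  apply: lspan_sum_seq => u; rewrite mem_words => /eqP su _.
  rewrite -mulr_algl; apply: (lspanZ (@kscalarM K Q)); first by exists (S k u).
  by have := g3 u; rewrite su.
(* The coefficients of all powers of z reassemble into a relation over K[z] between the rows of the
   minor. *)
have wmat0 v : \sum_(p | deg p == m) l p * wmat g polyC x y m p.1 v = 0.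
  have [sv|sv] := eqVneq (size v) m; last first.
    apply: big1 => p _; rewrite /wmat big1_seq ?mulr0 // => u /andP[_].
    rewrite mem_words => /eqP su; have [->|/g2[E]] := eqVneq (g u v) 0.
      by rewrite polyC0 mulr0.
    by rewrite E su eqxx in sv.
  apply/polyP => k; rewrite coef0 coef_sum -[RHS](S0 k v sv).
  under [RHS]eq_bigr do rewrite /S mulr_suml.
  rewrite exchange_big /=; apply: eq_bigr => p /eqP pm.
  rewrite /wmat mulr_sumr coef_sum; apply: eq_bigr => u _.
  by rewrite mulrA coefMC -pm /deg addKn.
have [f df] := xy m mr.
have pm_lt p : deg p == m -> (p.1 < m.+1)%N by move=> /eqP <-; rewrite ltnS leq_addr.
(* For total length [m] the first length determines the pair, so each [la a] has at most one
   term. *)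
pose la (a : 'I_m.+1) := \sum_(p | (deg p == m) && (inord p.1 == a)) l p.
have la0 : forall a, la a = 0.
  apply: (det_neq0_free df) => b; rewrite -[RHS](wmat0 (f b)).
  rewrite [RHS](partition_big (fun p : 'I_r * 'I_r => inord p.1 : 'I_m.+1) xpredT) //=.
  apply: eq_bigr => a _; rewrite mxE mulr_suml; apply: eq_bigr => p /andP[pm /eqP <-].
  by rewrite inordK ?pm_lt.
have := la0 (inord p1.1); rewrite /la (bigD1 p1) /= ?eqxx // big1 ?addr0 => [/eqP|p].
  by apply/negP.
move=> /andP[/andP[pm /eqP/(congr1 (@nat_of_ord _))]].
rewrite !inordK ?pm_lt // => E /negP[]; apply/eqP.
move/eqP: pm; rewrite /m /deg E => /addnI E2.
by case: p p1 E E2 {lp1 pmax m mr S Slow S0 wmat0 f df pm_lt la la0} => p q [p' q'] /= /val_inj-> /val_inj->.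
Qed.
End Trees.

(** * Counting over K[z] *)

Section PolyScalars.
Variables (K : fieldType) (Q : unitAlgType K).
Notation liftp := (@liftp K Q).

Definition pscalar (x : {poly Q}) := exists p, x = liftp p.

Lemma liftp_inj : injective liftp.
Proof.
move=> p q /polyP E; apply/polyP => k; have := E k.
rewrite !coef_map /= => /eqP; rewrite -subr_eq0 -scalerBl scaler_eq0 oner_eq0 orbF.
by rewrite subr_eq0 => /eqP.
Qed.

Lemma pscalar1 : pscalar 1. Proof. by exists 1; rewrite rmorph1. Qed.
Lemma pscalarB x y : pscalar x -> pscalar y -> pscalar (x - y).
Proof. by move=> [a ->] [b ->]; exists (a - b); rewrite rmorphB. Qed.
Lemma pscalarM x y : pscalar x -> pscalar y -> pscalar (x * y).
Proof. by move=> [a ->] [b ->]; exists (a * b); rewrite rmorphM. Qed.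
Lemma pscalarC x t : pscalar x -> t * x = x * t.
Proof. by move=> [a ->]; apply: liftp_central. Qed.
Lemma pscalar_dom x y : pscalar x -> pscalar y -> x * y = 0 -> x = 0 \/ y = 0.
Proof.
move=> [a ->] [b ->]; rewrite -rmorphM -(rmorph0 liftp) => /liftp_inj/eqP.
by rewrite mulf_eq0 => /orP[/eqP->|/eqP->]; [left|right].
Qed.
Lemma pscalar_ore x y : pscalar x -> pscalar y -> y != 0 ->
  exists u v, [/\ pscalar u, pscalar v, u != 0 & u * x = v * y].
Proof. by move=> px py y0; exists y, x; split=> //; rewrite (pscalarC _ px). Qed.

Lemma pscalar_fun (I : Type) (c : I -> {poly Q}) : (forall i, pscalar (c i)) ->
  exists k : I -> {poly K}, c = fun i => liftp (k i).
Proof. by move=> /choice[k kE]; exists k; apply/funext. Qed.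

Lemma pspan_polyC (s : seq Q) x : kspan s x ->
  lspan pscalar (fun y => y \in map polyC s) x%:P.
Proof.
elim=> [|_ y z [c ->] ys _ IH]; first by rewrite polyC0; left.
rewrite polyCD polyCM; apply: lspanS => //; last exact: map_f.
by exists c%:P; rewrite /liftp map_polyC.
Qed.

Lemma pfree_polyC (s : seq Q) (c : 'I_(size s) -> {poly K}) : kfree s ->
  \sum_i liftp (c i) * (s`_i)%:P = 0 -> forall i, c i = 0.
Proof.
move=> sfree E i; apply/polyP => k; rewrite coef0.
have /eqP : ((c i)`_k)%:A = 0 :> Q.
  apply: (sfree (fun i => ((c i)`_k)%:A)) => [j|]; first by exists (c j)`_k.
  have := congr1 (fun p : {poly Q} => p`_k) E; rewrite coef0 coef_sum => H.
  by rewrite -[RHS]H; apply: eq_bigr => j _; rewrite coef_liftpC mulr_algl.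
by rewrite scaler_eq0 oner_eq0 orbF => /eqP.
Qed.

Lemma pspan_cat (s t : seq Q) x :
  kspan (s ++ t) x -> exists (a : 'I_(size s) -> {poly K}) (b : 'I_(size t) -> {poly K}),
  x%:P = \sum_i liftp (a i) * (s`_i)%:P + \sum_i liftp (b i) * (t`_i)%:P.
Proof.
move=> xst; have zero_sum (r : seq Q) : \sum_i liftp 0 * (r`_(i : 'I_(size r)))%:P = 0.
  by apply: big1 => i _; rewrite rmorph0 mul0r.
have coord (r : seq Q) y c : y \in r -> exists a : 'I_(size r) -> {poly K},
    liftp c%:P * y%:P = \sum_i liftp (a i) * (r`_i)%:P.
  move=> yr; have yr' : (index y r < size r)%N by rewrite index_mem.
  exists (fun i => if i == Ordinal yr' then c%:P else 0).
  rewrite (bigD1 (Ordinal yr')) //= eqxx nth_index // big1 ?addr0 // => i /negbTE->.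
  by rewrite rmorph0 mul0r.
elim: xst => [|_ y z [c ->] yst _ [a [b zE]]].
  by exists (fun _ => 0), (fun _ => 0); rewrite !zero_sum addr0.
have cE : (c%:A * y)%:P = liftp c%:P * y%:P by rewrite polyCM /liftp map_polyC.
rewrite polyCD zE cE; move: yst; rewrite mem_cat => /orP[|] /coord-/(_ c)[a' ->].
  exists (fun i => a' i + a i), b; rewrite addrA; congr (_ + _).
  by rewrite -big_split; apply: eq_bigr => i _; rewrite rmorphD mulrDl.
exists a, (fun i => a' i + b i); rewrite addrCA; congr (_ + _).
by rewrite -big_split; apply: eq_bigr => i _; rewrite rmorphD mulrDl.
Qed.

(** Each of the [r] steps imposes the vanishing of [t] coordinates along [T]; these [r * t] linear
    conditions on [N] unknowns have a nonzero solution over K[z]. *)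
Lemma path_kernel N t r (E : 'I_N -> {poly Q}) (T : 'I_t -> {poly Q})
    (eta : nat -> {poly Q}) :
  (forall k i, exists (a : 'I_N -> {poly K}) (b : 'I_t -> {poly K}),
     eta k * E i = \sum_j liftp (a j) * E j + \sum_j liftp (b j) * T j) ->
  (r * t < N)%N ->
  exists2 c : 'I_N -> {poly K}, exists i, c i != 0 &
    forall k, (k <= r)%N -> exists c' : 'I_N -> {poly K},
      (\prod_(j <- rev (iota 0 k)) eta j) * \sum_i liftp (c i) * E i =
      \sum_i liftp (c' i) * E i.
Proof.
move=> etaE0 rtN; have [a aP] := choice (fun p : nat * 'I_N => etaE0 p.1 p.2).
have [b abE] := choice aP.
have etaE k i : eta k * E i = \sum_j liftp (a (k, i) j) * E j +
    \sum_j liftp (b (k, i) j) * T j by exact: (abE (k, i)).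
pose al k : 'M[{poly K}]_N := \matrix_(i, j) a (k, i) j.
pose be k : 'M[{poly K}]_(N, t) := \matrix_(i, j) b (k, i) j.
(* [cm k] gives the coordinates along [E] after [k] steps, as long as all earlier components along
   [T] vanish. *)
pose cm k : 'M[{poly K}]_N := iteri k (fun j M => M *m al j) 1%:M.
have [] := @ldep {poly K} (fun _ => True) I (fun _ _ _ _ => I)
  (fun _ _ _ _ => I) _ _ 'I_N ('I_r * 'I_t)%type
  (fun i p => (cm p.1 *m be p.1) i p.2).
- by move=> x y _ _ /eqP; rewrite mulf_eq0 => /orP[/eqP|/eqP]; [left|right].
- by move=> x y _ _ y0; exists y, x; split=> //; rewrite mulrC.
- by rewrite card_prod !card_ord.
- by [].
move=> c [_ cn0 c0]; exists c => // k kr.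
pose cr := \row_i c i; exists (fun i => (cr *m cm k) 0 i).
elim: k kr => [|k IH] kr.
  rewrite big_nil mul1r mulmx1; apply: eq_bigr => i _; by rewrite mxE.
rewrite -addn1 iotaD rev_cat big_cat /= big_seq1 -mulrA IH 1?ltnW // mulr_sumr.
have stepE i (p : {poly K}) : eta (0 + k)%N * (liftp p * E i) =
    \sum_j liftp p * (liftp (a (k, i) j) * E j) +
    \sum_j liftp p * (liftp (b (k, i) j) * T j).
  by rewrite mulrA liftp_central -mulrA etaE mulrDr !mulr_sumr.
rewrite (eq_bigr _ (fun i _ => stepE i _)).
rewrite big_split /= addn1 /cm iteriS -/(cm k) mulmxA.
rewrite [X in _ + X](_ : _ = 0) ?addr0; last first.
  rewrite exchange_big big1 //= => j _.
  transitivity (liftp ((cr *m (cm k *m be k)) 0 j) * T j).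
    rewrite mulmxA [in RHS]mxE rmorph_sum mulr_suml; apply: eq_bigr => i _.
    by rewrite rmorphM mulrA !mxE.
  rewrite mxE [X in liftp X](_ : _ = 0) ?rmorph0 ?mul0r //.
  rewrite -[RHS](c0 (Ordinal kr, j)); apply: eq_bigr => i _.
  by rewrite [cr _ _]mxE.
rewrite exchange_big; apply: eq_bigr => j _ /=.
rewrite [in RHS]mxE rmorph_sum mulr_suml; apply: eq_bigr => i _.
by rewrite rmorphM mulrA [al k _ _]mxE.
Qed.

(** The path grows on the right, so its last factor acts first on [E]: the new products lie in the
    old prefix [P] times [E], already spanned by [L], plus [P] times [T]. Each step thus costs
    [size T]. *)
Lemma left_path_span (E T : seq {poly Q}) (xi : nat -> {poly Q}) r :
  (forall k e, e \in E -> lspan pscalar (fun y => y \in E ++ T) (xi k * e)) ->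
  exists2 L : seq {poly Q}, size L = (size E + r * size T)%N &
    forall a e, (a <= r)%N -> e \in E ->
      lspan pscalar (fun y => y \in L) ((\prod_(j <- iota 0 a) xi j) * e).
Proof.
move=> xiE; elim: r => [|r [L sL LP]].
  exists E; first by rewrite mul0n addn0.
  move=> a e; rewrite leqn0 => /eqP-> eE; rewrite big_nil mul1r.
  exact: (lspan_gen pscalar1).
pose P := \prod_(j <- iota 0 r) xi j.
exists (L ++ [seq P * t | t <- T]); 
  first by rewrite size_cat sL size_map mulSn -addnA [(r * _ + _)%N]addnC.
have LL y : lspan pscalar (fun y => y \in L) y ->
    lspan pscalar (fun y => y \in L ++ [seq P * t | t <- T]) y.
  apply: (lspan_sub pscalarM) => z zL; apply: (lspan_gen pscalar1).
  by rewrite mem_cat zL.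
move=> a e; rewrite leq_eqVlt => /predU1P[->|]; last first.
  by rewrite ltnS => ar eE; apply/LL/LP.
move=> eE; rewrite -addn1 iotaD big_cat /= big_seq1 -/P -mulrA.
apply: (lspan_mull pscalarM) (xiE _ _ eE) => [c Cc|y].
  by rewrite (pscalarC _ Cc).
rewrite mem_cat => /orP[yE|yT]; first by apply/LL/LP.
by apply: (lspan_gen pscalar1); rewrite mem_cat map_f ?orbT.
Qed.

End PolyScalars.

(** * The counting inequality *)

Section Core.
Variables (K : fieldType) (Q : unitAlgType K) (D : Q -> Prop).
Hypothesis Dsub : is_subalgebra D.
Notation liftp := (@liftp K Q).

Definition dpoly (p : {poly Q}) := forall k, D p`_k.

Let D1 : D 1. Proof. by case: Dsub. Qed.
Let DD x y : D x -> D y -> D (x + y). Proof. by case: Dsub => _ [+ _]; apply. Qed.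
Let DM x y : D x -> D y -> D (x * y). Proof. by case: Dsub => _ [_ [+ _]]; apply. Qed.
Let DZ (k : K) x : D x -> D (k *: x). Proof. by case: Dsub => _ [_ [_ +]]; apply. Qed.
Let D0 : D 0. Proof. by rewrite -(scale0r 1); apply: DZ. Qed.

Lemma dpolyC x : D x -> dpoly x%:P.
Proof. by move=> Dx k; rewrite coefC; case: ifP. Qed.
Lemma dpolyD p q : dpoly p -> dpoly q -> dpoly (p + q).
Proof. by move=> Dp Dq k; rewrite coefD; apply: DD. Qed.
Lemma dpolyM p q : dpoly p -> dpoly q -> dpoly (p * q).
Proof.
by move=> Dp Dq k; rewrite coefM; elim/big_ind: _ => // i _; apply: DM.
Qed.
Lemma dpoly_liftp p : dpoly (liftp p).
Proof. by move=> k; rewrite coef_map /=; apply: DZ. Qed.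
Lemma dpoly_sum (I : finType) (F : I -> {poly Q}) :
  (forall i, dpoly (F i)) -> dpoly (\sum_i F i).
Proof.
move=> DF; elim/big_ind: _ => //; last exact: dpolyD.
by rewrite -polyC0; apply: dpolyC.
Qed.
Lemma dpoly_prod (T : Type) (s : seq T) (F : T -> {poly Q}) :
  (forall i, dpoly (F i)) -> dpoly (\prod_(i <- s) F i).
Proof.
move=> DF; elim/big_ind: _ => //; last exact: dpolyM.
by rewrite -polyC1; apply: dpolyC.
Qed.

Lemma coefM_top (p q : {poly Q}) m n : (size p <= m.+1)%N -> (size q <= n.+1)%N ->
  (p * q)`_(m + n) = p`_m * q`_n.
Proof.
move=> pm qn; rewrite coefM (bigD1 (@Ordinal (m + n).+1 m (leq_addr _ _))) //= addKn.
rewrite big1 ?addr0 // => i; rewrite -val_eqE /= neq_ltn => /orP[im|mi].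
  by rewrite [q`__]nth_default ?mulr0 // (leq_trans qn) //; lia.
by rewrite nth_default ?mul0r // (leq_trans pm).
Qed.

(* Comparing top coefficients in the central variable reduces freeness over D[z] to freeness over D. *)
Lemma dpoly_free (us : seq Q) (g : {poly Q}) (f : 'I_(size us) -> {poly Q}) :
  lfree D (fun j : 'I_(size us) => lead_coef g * us`_j) ->
  (forall j, dpoly (f j)) -> \sum_j f j * (g * (us`_j)%:P) = 0 ->
  forall j, f j = 0.
Proof.
move=> gfree Df f0; pose H := \max_j size (f j).
have [H0 j|Hpos] := posnP H.
  by apply/eqP; rewrite -size_poly_eq0 -leqn0 -[X in (_ <= X)%N]H0; apply: leq_bigmax.
have top0 : forall j, (f j)`_H.-1 = 0.
  apply: gfree => [j|]; first exact: Df.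
  have := congr1 (fun p : {poly Q} => p`_(H.-1 + (size g).-1)) f0.
  rewrite coef0 coef_sum => E; rewrite -[RHS]E; apply: eq_bigr => j _.
  rewrite mulrA coefMC coefM_top ?mulrA //; last exact: leqSpred.
  by rewrite prednK //; apply: leq_bigmax.
case: (posnP (size us)) => [us0|us_pos]; first by case=> j jus; exfalso; move: jus; rewrite us0.
have [|j1 Hj1] := @bigop.eq_bigmax 'I_(size us) (fun j => size (f j)).
  by rewrite card_ord.
have := top0 j1; rewrite /H Hj1 => /eqP; rewrite -[_`_ _]/(lead_coef _) lead_coef_eq0.
by rewrite -size_poly_eq0 -Hj1 -/H => /eqP H0; rewrite H0 in Hpos.
Qed.

(** The elements p_a p'_i g u are counted in two ways. By [path_kernel] the p'_i g stay in the span
    of [E], so the p'_i g u lie in that of [E2], and [left_path_span] bounds the span of all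
    products. They are independent because the g u are free over D[z] and the p_a p'_i are free over
    K[z]. *)
Lemma core_count d (w : 'I_d -> Q) (x y : nat -> 'I_d -> {poly K}) r
    (E T E2 T2 U : seq Q) nu :
  (forall c, D (w c)) ->
  (forall l : 'I_r * 'I_r -> {poly K},
     \sum_p liftp (l p) * \prod_(c <- coef_list x y p.1 p.2) letter_comb w c = 0 ->
     forall p, l p = 0) ->
  kfree E -> (r * size T < size E)%N ->
  (forall c e, e \in E -> kspan (E ++ T) (w c * e)) ->
  (forall c e, e \in E2 -> kspan (E2 ++ T2) (w c * e)) ->
  (forall e u, e \in E -> u \in U -> kspan E2 (e * u)) ->
  (forall g, g != 0 -> exists us : seq Q, [/\ size us = nu, {subset us <= U} &
     lfree_seq D [seq g * u | u <- us]]) ->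
  (r * r * nu <= size E2 + r * size T2)%N.
Proof.
move=> Dw qfree Efree rT wE wE2 Eus Dfree.
pose xi k := letter_comb w (x k); pose eta k := letter_comb w (y k).
have qE (a i : nat) : \prod_(c <- coef_list x y a i) letter_comb w c =
    (\prod_(j <- iota 0 a) xi j) * (\prod_(j <- rev (iota 0 i)) eta j).
  by rewrite /coef_list big_cat /mkseq -map_rev !big_map.
pose EP (i : 'I_(size E)) : {poly Q} := (E`_i)%:P.
pose TP (i : 'I_(size T)) : {poly Q} := (T`_i)%:P.
have etaE k i : exists (a : 'I_(size E) -> {poly K}) (b : 'I_(size T) -> {poly K}),
    eta k * EP i = \sum_j liftp (a j) * EP j + \sum_j liftp (b j) * TP j.
  have wEi c := pspan_cat (wE c _ (mem_nth 0 (ltn_ord i))).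
  have [a /choice[b abE]] := choice wEi.
  exists (fun j => \sum_c y k c * a c j), (fun j => \sum_c y k c * b c j).
  rewrite /eta /letter_comb mulr_suml.
  under eq_bigr => c _ do rewrite -mulrA -polyCM abE mulrDr !mulr_sumr.
  rewrite big_split /=; congr (_ + _); rewrite exchange_big; apply: eq_bigr => j _ /=.
    by rewrite rmorph_sum mulr_suml; apply: eq_bigr => c _; rewrite rmorphM mulrA.
  by rewrite rmorph_sum mulr_suml; apply: eq_bigr => c _; rewrite rmorphM mulrA.
have [c [i0 ci0] cP] := path_kernel etaE rT.
pose g : {poly Q} := \sum_i liftp (c i) * EP i.
have g0 : g != 0.
  apply: contra ci0 => /eqP gE; apply/eqP.
  exact: (pfree_polyC Efree gE).
(* [Dfree] speaks of elements of Q, so it is applied to the leading coefficient of [g]; [dpoly_free]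
   then recovers freeness over D[z]. *)
have [us [sus usU usfree]] : exists us : seq Q, [/\ size us = nu, {subset us <= U} &
    lfree_seq D [seq lead_coef g * u | u <- us]] by apply: Dfree; rewrite lead_coef_eq0.
rewrite -sus; have {}usfree : lfree D (fun j : 'I_(size us) => lead_coef g * us`_j).
  move: usfree; rewrite /lfree_seq size_map => H f Df f0; apply: H => //.
  by rewrite -[RHS]f0; apply: eq_bigr => j _; rewrite (nth_map 0).
have pspanE2 i u : (i <= r)%N -> u \in us -> lspan (@pscalar K Q)
    (fun z => z \in map polyC E2) ((\prod_(j <- rev (iota 0 i)) eta j) * g * u%:P).
  move=> ir uus; have [c' ->] := cP i ir.
  rewrite mulr_suml; apply: lspan_sum => j _; rewrite -mulrA.
  apply: (lspanZ (@pscalarM K Q)); first by exists (c' j).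
  by rewrite -polyCM; apply/pspan_polyC/Eus; [apply: mem_nth|apply: usU].
have xiE k e : e \in map polyC E2 -> lspan (@pscalar K Q)
    (fun z => z \in map polyC E2 ++ map polyC T2) (xi k * e).
  move=> /mapP[e' e'E ->]; rewrite mulr_suml; apply: lspan_sum => j _; rewrite -mulrA.
  apply: (lspanZ (@pscalarM K Q)); first by exists (x k j).
  by rewrite -polyCM -map_cat; apply/pspan_polyC/wE2.
have [L sL LP] := left_path_span r xiE.
have := @lfree_size _ (@pscalar K Q) (@pscalar1 K Q) (@pscalarB K Q) (@pscalarM K Q)
  (@pscalar_dom K Q) (@pscalar_ore K Q) (('I_r * 'I_r) * 'I_(size us))%type
  (fun p => (\prod_(c <- coef_list x y p.1.1 p.1.2) letter_comb w c) *
            (g * (us`_p.2)%:P)) L.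
rewrite sL !size_map !card_prod !card_ord; apply.
  move=> f /pscalar_fun[l ->] f0 p; rewrite (_ : l p = 0) ?rmorph0 //.
  case: p => p j; apply: (qfree (fun p => l (p, j))); move: j.
  apply: (dpoly_free usfree).
    move=> j; apply: dpoly_sum => p'; apply: dpolyM; first exact: dpoly_liftp.
    apply: dpoly_prod => c'; apply: dpoly_sum => a; apply: dpolyM.
      exact: dpoly_liftp.
    exact: dpolyC.
  rewrite -[RHS]f0; under eq_bigr do rewrite mulr_suml.
  rewrite exchange_big pair_big /=; apply: eq_bigr => -[p' j] _ /=.
  by rewrite -mulrA.
move=> [[a i] j] /=; rewrite qE -!mulrA.
have sp := pspanE2 i (us`_j) (ltnW (ltn_ord i)) (mem_nth 0 (ltn_ord j)).
rewrite [X in _ * X]mulrA.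
apply: (lspan_mull (@pscalarM K Q)) sp => [b Cb|z zE]; first by rewrite (pscalarC _ Cb).
by apply: LP => //; apply: ltnW.
Qed.

End Core.

(** * Denominators and left independence over D *)

Section Powers.
Variables (K : fieldType) (Q : unitAlgType K).
Implicit Types s : seq Q.

Let k1 := @kscalar1 K Q.
Let kM := @kscalarM K Q.

Lemma kspan_cut (s t : seq Q) x : (forall y, y \in s -> kspan t y) ->
  kspan s x -> kspan t x.
Proof. exact: (lspan_sub kM). Qed.

Lemma kspan_mulr (s t : seq Q) x z : (forall y, y \in s -> kspan t (y * z)) ->
  kspan s x -> kspan t (x * z).
Proof. exact: (lspan_mulr kM). Qed.

Lemma kspan_mull (s t : seq Q) x z : (forall y, y \in s -> kspan t (z * y)) ->
  kspan s x -> kspan t (z * x).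
Proof. by apply: (lspan_mull kM) => c Cc; rewrite (kscalarC z Cc). Qed.

Lemma kspan_mem (s : seq Q) x : x \in s -> kspan s x.
Proof. exact: (lspan_gen k1). Qed.

Lemma pow_gensS s n x y : x \in pow_gens s n -> y \in 1 :: s ->
  x * y \in pow_gens s n.+1.
Proof. by move=> xs ys; apply/allpairsP; exists (x, y). Qed.

Lemma pow_gens_ind s n z : z \in pow_gens s n.+1 ->
  exists x y, [/\ x \in pow_gens s n, y \in 1 :: s & z = x * y].
Proof. by move=> /allpairsP[[x y] /= [? [? ->]]]; exists x, y. Qed.

Lemma pow_gensD s m n x y : x \in pow_gens s m -> y \in pow_gens s n ->
  x * y \in pow_gens s (m + n).
Proof.
move=> xm; elim: n y => [|n IH] y.
  by rewrite inE addn0 => /eqP->; rewrite mulr1.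
move=> /pow_gens_ind[u [v [un vs ->]]]; rewrite addnS mulrA.
by apply: pow_gensS => //; apply: IH.
Qed.

Lemma pow_gens1 s n : 1 \in pow_gens s n.
Proof.
elim: n => [|n IH]; first exact: mem_head.
by rewrite -[1]mulr1; apply: pow_gensS => //; apply: mem_head.
Qed.

Lemma pow_gens_mono s m n x : (m <= n)%N -> x \in pow_gens s m -> x \in pow_gens s n.
Proof.
by move=> mn xm; rewrite -[x]mulr1 -(subnKC mn); apply: pow_gensD => //; apply: pow_gens1.
Qed.

Lemma kspan_powD s m n x y : kspan (pow_gens s m) x -> kspan (pow_gens s n) y ->
  kspan (pow_gens s (m + n)) (x * y).
Proof.
move=> xm yn; apply: kspan_mulr xm => u um; apply: kspan_mull yn => v vn.
by apply/kspan_mem/pow_gensD.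
Qed.

Lemma kspan_pow_mono s m n x : (m <= n)%N ->
  kspan (pow_gens s m) x -> kspan (pow_gens s n) x.
Proof. by move=> mn; apply: kspan_cut => y ym; apply/kspan_mem/(pow_gens_mono mn). Qed.

Lemma leq_dimspan_span (ws vs : seq Q) : (forall x, x \in ws -> kspan vs x) ->
  (dimspan ws <= dimspan vs)%N.
Proof.
move=> wsvs; have [e [efree <- ews _]] := dimspan_basis ws.
rewrite -[size e]card_ord; apply: (leq_dimspan efree) => i.
by apply/wsvs/ews/mem_nth.
Qed.

Lemma growth_mono s m n : (m <= n)%N -> (growth_fun s m <= growth_fun s n)%N.
Proof.
by move=> mn; apply: leq_dimspan_span => x xm; apply/kspan_mem/(pow_gens_mono mn).
Qed.

Lemma growth_gt0 s n : (0 < growth_fun s n)%N.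
Proof.
have [e [_ se _ espan]] := dimspan_basis (pow_gens s n).
rewrite /growth_fun -se; case: e espan {se} => // /(_ _ (pow_gens1 s n)) H.
suff : 1 = 0 :> Q by move/eqP; rewrite oner_eq0.
by elim: H.
Qed.

Lemma pow_gens_wordp s n : {subset pow_gens s n <=
  [seq wordp (fun c : 'I_(size s).+1 => (1 :: s)`_c) u | u <- words _ n]}.
Proof.
move=> x xn; suff [u su ->] : exists2 u, size u = n &
    x = wordp (fun c : 'I_(size s).+1 => (1 :: s)`_c) u.
  by apply: map_f; rewrite mem_words su.
elim: n x xn => [|n IH] x.
  by rewrite inE => /eqP->; exists [::] => //; rewrite /wordp big_nil.
move=> /pow_gens_ind[y [z [/IH[u su ->] zs ->]]].
have zs' : (index z (1%R :: s) < (size s).+1)%N by rewrite index_mem.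
exists (rcons u (Ordinal zs')); first by rewrite size_rcons su.
by rewrite -cats1 wordp_cat /wordp big_seq1 /= (nth_index 0 zs).
Qed.

End Powers.

Section Quotients.
Variables (K : fieldType) (Q : unitAlgType K) (A : Q -> Prop) (s : seq Q).
Hypotheses (As : generated_by A s) (QA : is_quotient_division_algebra_of A).

Let Qunit (x : Q) : x != 0 -> x \is a GRing.unit. Proof. by case: QA => + _; apply. Qed.
Let AM x y : A x -> A y -> A (x * y).
Proof. by case: QA => _ [[_ [_ [+ _]]] _]; apply. Qed.
Let A1 : A 1. Proof. by case: QA => _ [[]]. Qed.
Let Qfrac q : exists a b, A a /\ A b /\ b != 0 /\ q = a * b^-1.
Proof. by case: QA => _ [_ +]; apply. Qed.

Lemma divalg_mul_neq0 (x y : Q) : x != 0 -> y != 0 -> x * y != 0.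
Proof.
move=> /Qunit ux y0; apply: contra y0 => /eqP xy.
by rewrite -[y]mul1r -(mulVr ux) -mulrA xy mulr0.
Qed.

Lemma algebra_spanP x : A x <-> exists n, kspan (pow_gens s n) x.
Proof.
rewrite As; split=> -[n xn]; exists n; exact/in_spanP.
Qed.

(** If x = a c^-1 and c^-1 b = a' c'^-1, then x b c' = a a', so [b * c'] clears one more element. *)
Lemma common_denominator (l : seq Q) : exists b, [/\ A b, b != 0 &
  forall x, x \in l -> A (x * b)].
Proof.
elim: l => [|x l [b [Ab b0 lb]]]; first by exists 1; rewrite oner_neq0.
have [a [c [Aa [Ac [c0 xE]]]]] := Qfrac x.
have [a' [c' [Aa' [Ac' [c'0 cbE]]]]] := Qfrac (c^-1 * b).
exists (b * c'); split; [exact: AM|exact: divalg_mul_neq0|].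
move=> y; rewrite inE => /predU1P[->|yl]; last by rewrite mulrA; apply: AM => //; apply: lb.
suff -> : x * (b * c') = a * a' by exact: AM.
by rewrite xE -mulrA; congr (_ * _); rewrite mulrA cbE mulrVK // Qunit.
Qed.

Lemma bounded_denominator (l : seq Q) : exists b m, b != 0 /\
  forall x, x \in 1 :: l -> kspan (pow_gens s m) (x * b).
Proof.
have [b [Ab b0 lb]] := common_denominator (1 :: l).
exists b; suff [m mP] : exists m, forall x, x \in 1 :: l -> kspan (pow_gens s m) (x * b).
  by exists m.
elim: (1 :: l) lb => [|x t IH] tb; first by exists 0%N.
have [y yt|m mP] := IH; first by apply: tb; rewrite inE yt orbT.
have /algebra_spanP[k kP] := tb x (mem_head _ _).
exists (maxn k m) => y; rewrite inE => /predU1P[->|yt].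
  by apply: kspan_pow_mono kP; apply: leq_maxl.
by apply: kspan_pow_mono (mP y yt); apply: leq_maxr.
Qed.

(** Left multiplication by [b] is injective, so b V^n has dimension [growth_fun s n]. Its multiples
    by [1 :: l] lie in V^(m+n), and [T] completes a basis of b V^n to one of V^(m+n), which bounds
    [size T]. *)
Lemma ex_folner (l : seq Q) b m n : b != 0 ->
  (forall x, x \in 1 :: l -> kspan (pow_gens s m) (x * b)) ->
  exists E T, [/\ kfree E, size E = growth_fun s n,
    (size T + growth_fun s n <= growth_fun s (m + n))%N,
    (forall c e, c \in 1 :: l -> e \in E -> kspan (E ++ T) (c * e)) &
    (forall e, e \in E -> exists2 y, y \in pow_gens s n & e = b * y) /\
    (forall y, kspan (pow_gens s n) y -> kspan E (b * y))].
Proof.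
move=> b0 lb; have ub := Qunit b0.
have [e [efree se esub espan]] := dimspan_basis (pow_gens s n).
have [F [_ _ Fsub Fspan]] := dimspan_basis (pow_gens s (m + n)).
pose E := [seq b * y | y <- e].
have Efree : kfree E.
  rewrite /lfree_seq size_map => c Cc E0 i; apply: (efree c) => //.
  have : b * \sum_(j < size e) c j * e`_j = 0.
    rewrite mulr_sumr -[RHS]E0; apply: eq_bigr => j _.
    by rewrite mulrA (kscalarC b (Cc j)) -mulrA (nth_map 0).
  move=> /(congr1 (fun y => b^-1 * y)); rewrite mulr0 mulrA mulVr // mul1r.
  by [].
have [mk [_ ETfree ETspan]] := kfree_extend F Efree.
set T := mask mk F in ETfree ETspan.
have Epow y c : c \in 1 :: l -> y \in E -> kspan (pow_gens s (m + n)) (c * y).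
  move=> cl /mapP[z ze ->]; rewrite mulrA; apply: kspan_powD; first exact: lb.
  by apply: kspan_mem; apply: esub.
exists E, T; split=> //; first by rewrite size_map.
- rewrite /growth_fun -se -(size_map (fun y => b * y) e) -/E addnC -size_cat -[size _]card_ord.
  apply: (leq_dimspan ETfree) => i.
  have := mem_nth 0 (ltn_ord i); rewrite mem_cat => /orP[iE|iT].
    by rewrite -[_`_i]mul1r; apply: Epow => //; apply: mem_head.
  by apply/kspan_mem/Fsub/(mem_mask iT).
- move=> c y cl yE; have := Epow y c cl yE; apply: kspan_cut => z /Fspan.
  by apply: kspan_cut => t; apply: ETspan.
split=> [y /mapP[z ze ->]|y yn]; first by exists z => //; apply: esub.
apply: kspan_mull yn => z /espan; apply: kspan_mull => t te.
by apply: kspan_mem; apply: map_f.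
Qed.

(** * Left D-dimension when Q is infinite dimensional over D *)

Section InfiniteIndex.
Variable D : Q -> Prop.
Hypotheses (Ddiv : is_division_subalgebra D) (Dinf : ~ left_fin_dim_over D).

Let D1 : D 1. Proof. by case: Ddiv => -[]. Qed.
Let DM x y : D x -> D y -> D (x * y).
Proof. by case: Ddiv => -[_ [_ [+ _]]] _; apply. Qed.
Let DB x y : D x -> D y -> D (x - y).
Proof.
case: Ddiv => -[_ [DD [_ DZ]]] _ Dx Dy; apply: DD => //.
by rewrite -scaleN1r; apply: DZ.
Qed.
Let DV x : D x -> x != 0 -> exists2 y, D y & y * x = 1.
Proof.
move=> Dx x0; exists x^-1; last by rewrite mulVr // Qunit.
by case: Ddiv => _; apply.
Qed.
Notation dspan t := (lspan D (fun y => y \in t)).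

Lemma dfree_size (I : finType) (F : I -> Q) (t : seq Q) :
  lfree D F -> (forall i, dspan t (F i)) -> (#|I| <= size t)%N.
Proof.
apply: (lfree_size D1 DB DM); first exact: (division_dom DV).
exact: (division_ore D1 DM DV).
Qed.

(* A finite-dimensional left D-space that is stable under right multiplication by b is stable under b^-1: the vectors x b^i are left dependent, and the relation can be divided by the lowest power of b. *)
Lemma dspan_inv (t : seq Q) b : b != 0 ->
  (forall y, dspan t y -> dspan t (y * b)) -> forall x, dspan t x -> dspan t (x * b^-1).
Proof.
move=> b0 tb x tx; have ub := Qunit b0.
have txb i : dspan t (x * b ^+ i).
  by elim: i => [|i IH]; rewrite ?expr0 ?mulr1 // exprSr mulrA; apply: tb.
pose F (i : 'I_(size t).+1) := x * b ^+ i.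
have nfree : ~ lfree D F.
  by move=> /dfree_size/(_ (fun i => txb i)); rewrite card_ord ltnn.
move: nfree => /existsNP[c] /not_implyP[Dc] /not_implyP[cF] /existsNP[i /eqP ci].
pose P k := `[< exists j : 'I_(size t).+1, c j != 0 /\ j = k :> nat >].
have exP : exists k, P k by exists i; apply/asboolP; exists i.
have [k /asboolP[j [cj jk]] kmin] := ex_minnP exP.
have [y Dy yc] := DV (Dc j) cj.
have dZ := lspanZ DM.
suff cxb : dspan t (c j * (x * b^-1)).
  by rewrite -[x * _]mul1r -yc -mulrA; apply: dZ.
have := congr1 (fun z => z * b ^- k.+1) cF; rewrite mul0r mulr_suml (bigD1 j) //=.
have -> : c j * F j * b ^- k.+1 = c j * (x * b^-1).
  rewrite /F jk -!mulrA; congr (_ * (_ * _)).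
  by rewrite exprS invrM ?unitrX // mulrA mulrV ?unitrX // mul1r.
move=> /eqP; rewrite addr_eq0 => /eqP->; apply: (lspanN D1 DB DM).
apply: lspan_sum => a aj; have [->|ca] := eqVneq (c a) 0; first by rewrite !mul0r; left.
have ka : (k < a)%N.
  rewrite ltn_neqAle kmin ?andbT; last by apply/asboolP; exists a.
  by rewrite -jk eq_sym; apply: contra aj => /eqP/val_inj->.
rewrite /F -!mulrA; apply: dZ => //.
rewrite -(subnK ka) exprD -mulrA mulrV ?unitrX // mulr1.
exact: txb.
Qed.

(** The span is stable under [A], and by [dspan_inv] under inverses of nonzero elements of [A], so
    it contains every g (g^-1 q) and Q would be finite dimensional. *)
Lemma dspan_full (t : seq Q) g : g != 0 -> dspan t g ->
  (forall x y, y \in s -> dspan t x -> dspan t (x * y)) -> False.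
Proof.
move=> g0 tg ts; apply: Dinf.
have tpow n x y : y \in pow_gens s n -> dspan t x -> dspan t (x * y).
  elim: n y => [|n IH] y; first by rewrite inE => /eqP->; rewrite mulr1.
  move=> /pow_gens_ind[u [v [un vs ->]]] tx; rewrite mulrA.
  move: vs; rewrite inE => /predU1P[->|vs]; first by rewrite mulr1; apply: IH.
  by apply: ts => //; apply: IH.
have tA x a : A a -> dspan t x -> dspan t (x * a).
  move=> /algebra_spanP[n an] tx; elim: an => [|_ y z [k ->] yn _ IH].
    by rewrite mulr0; left.
  rewrite mulrDr; apply: lspanD => //.
  rewrite mulr_algl -scalerAr -mulr_algl; apply: (lspanZ DM); last exact: (tpow n).
  by case: Ddiv => -[_ [_ [_ DZ]]] _; apply: DZ.
exists t => q; have [a [b [Aa [Ab [b0 qE]]]]] := Qfrac (g^-1 * q).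
have : dspan t q.
  rewrite -[q]mul1r -(mulrV (Qunit g0)) -mulrA qE mulrA.
  by apply: dspan_inv => // [y|]; apply: tA.
by move=> /(lspan_seqP D1 DB DM)[c Dc ->]; exists c.
Qed.

(** Each power adds a dimension: if g V^(n+1) lay in the D-span of the [g * u] with the [u] in V^n,
    that span would be stable under [s], against [dspan_full]. *)
Lemma ex_dfree n g : g != 0 -> exists us : seq Q,
  [/\ size us = n.+1, {subset us <= pow_gens s n} &
      lfree_seq D [seq g * u | u <- us]].
Proof.
move=> g0; elim: n => [|n [us [sus usn usfree]]].
  exists [:: 1]; split=> // c Dc; rewrite big_ord1 /= mulr1 => cg [[|//] i].
  apply/eqP; apply/negPn/negP => c0.
  have : c ord0 * g != 0.
    by apply: divalg_mul_neq0 => //; apply: contra c0 => /eqP<-; apply/eqP; congr c; apply: val_inj.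
  by rewrite cg eqxx.
have [[y yn nspan]|nex] := pselect (exists2 y, y \in pow_gens s n.+1 &
    ~ dspan [seq g * u | u <- us] (g * y)).
  exists (rcons us y); split; first by rewrite size_rcons sus.
    move=> u; rewrite mem_rcons inE => /predU1P[->//|/usn].
    exact: pow_gens_mono.
  by rewrite map_rcons; apply: (lfree_rcons D1 DB DM DV).
have span y : y \in pow_gens s n.+1 -> dspan [seq g * u | u <- us] (g * y).
  by move=> yn; apply: contrapT => ny; apply: nex; exists y.
exfalso; apply: (dspan_full g0 (t := [seq g * u | u <- us])).
  by have := span 1 (pow_gens1 s n.+1); rewrite mulr1.
move=> x y ys; apply: (lspan_mulr DM) => _ /mapP[u uus ->].
rewrite -mulrA; apply: span; apply: pow_gensS; first exact: usn.
by rewrite inE ys orbT.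
Qed.

End InfiniteIndex.
End Quotients.

(** * Growth *)

Section Asymptotics.
Local Notation R := Rdefinitions.R.
Implicit Types v : nat -> nat.

Definition log_growth v (n : nat) : \bar R := (ln ((v n)%:R : R) / ln (n%:R : R))%:E.

Lemma ln_nat_large (c : R) : exists N : nat, forall n, (N <= n)%N -> c <= ln (n%:R : R).
Proof.
exists (Num.truncn (expR c)).+1 => n Nn.
have cn : expR c <= n%:R.
  apply: ltW; apply: lt_le_trans (truncnS_gt _) _; by rewrite ler_nat.
by rewrite -[c]expRK ler_ln ?posrE ?expR_gt0 // (lt_le_trans _ cn) ?expR_gt0.
Qed.

(** Eventually v(n) <= n^r for some r < 3, and n^(3 - r) eventually exceeds any constant. *)
Lemma subcubic v : (forall n, (0 < v n)%N) -> (limn_esup (log_growth v) < 3%:E)%E ->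
  forall c, exists N, forall n, (N <= n)%N -> (c * v n <= n ^ 3)%N.
Proof.
move=> v0 /ereal_inf_lt[_ [V [N _ NV] <-] Vlt] c.
have [r r3 Vr] : exists2 r : R, r < 3 & forall n, V n -> ln ((v n)%:R : R) / ln (n%:R : R) <= r.
  have ub n : V n -> (log_growth v n <= ereal_sup [set log_growth v x | x in V]%classic)%E.
    by move=> Vn; apply: ereal_sup_ubound; exists n.
  move: Vlt ub; case: (ereal_sup _) => [r|//|] r3 ub.
    by exists r; rewrite -?lte_fin // => n /ub; rewrite lee_fin.
  by have := ub N (NV N (leqnn N)); rewrite leeNy_eq.
have [->|c0] := posnP c; first by exists 0%N => n _; rewrite mul0n.
have [N1 N1P] := ln_nat_large (ln (c%:R : R) / (3 - r)).
exists (maxn N (maxn N1 2)) => n; rewrite !geq_max => /andP[Nn /andP[N1n n2]].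
have n_gt0 : (0 < n)%N by apply: leq_trans n2.
have n0 : (0 : R) < n%:R by rewrite ltr0n.
have lnn : 0 < ln (n%:R : R) by rewrite ln_gt0 // ltr1n.
have := Vr n (NV n Nn); rewrite ler_pdivrMr // => vr.
have := N1P n N1n; rewrite ler_pdivrMr ?subr_gt0 // => cr.
rewrite -(ler_nat R) natrM natrX -ler_ln ?posrE ?mulr_gt0 ?exprn_gt0 ?ltr0n //.
rewrite lnM ?posrE ?ltr0n // lnXn //; nra.
Qed.

(** If v(n) <= c (n + 1) throughout, then ln v(n) <= ln(2c) + ln n, which is at most 3/2 ln n once
    ln n >= 2 ln(2c). *)
Lemma superlinear v : (forall n, (0 < v n)%N) ->
  ((3 / 2)%:E < limn_esup (log_growth v))%E -> forall c, exists n, (c * n.+1 < v n)%N.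
Proof.
move=> v0 vsup c; apply: contrapT => /forallNP nv.
have vc n : (v n <= c * n.+1)%N by rewrite leqNgt; apply/negP/nv.
move: vsup; apply/negP; rewrite -leNgt.
have c0 : (0 < c)%N by have := leq_trans (v0 0%N) (vc 0%N); rewrite muln1.
have [N NP] := ln_nat_large (2 * ln ((2 * c)%N%:R : R)).
pose V : set nat := [set n : nat | (maxn N 2 <= n)%N]%classic.
apply: (@le_trans _ _ (ereal_sup [set log_growth v n | n in V]%classic)).
  by apply: ereal_inf_lbound; exists V => //; exists (maxn N 2).
apply: ge_ereal_sup => z [n]; rewrite /V /= geq_max => /andP[Nn n2] <-.
have n_gt0 : (0 < n)%N by apply: leq_trans n2.
have lnn : 0 < ln (n%:R : R) by rewrite ln_gt0 // ltr1n.
rewrite lee_fin ler_pdivrMr //.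
have := NP n Nn => cn.
have : ln ((v n)%:R : R) <= ln ((2 * c * n)%N%:R : R).
  rewrite ler_ln ?posrE ?ltr0n ?muln_gt0 ?c0 // ler_nat.
  by apply: leq_trans (vc n) _; nia.
rewrite natrM lnM ?posrE ?ltr0n ?muln_gt0 ?c0 // => H; lra.
Qed.

End Asymptotics.

(** Both scales are handled through [phi n], the product of [f n] and [f (n + n)]. If every n >= n0
    failed, one of the factors, hence [phi], would grow by at least 1 + C / n from n to n + m. A
    doubling of n then gives a factor 128, whereas the cubic bound allows only 64 on average. *)
Lemma ex_folner_scale (f : nat -> nat) m : (0 < m)%N ->
  (forall n, (0 < f n)%N) -> (forall i j, (i <= j)%N -> (f i <= f j)%N) ->
  (exists N, forall n, (N <= n)%N -> (f n <= n ^ 3)%N) ->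
  exists2 C, (0 < C)%N & forall n0, exists n, [/\ (n0 <= n)%N,
    (n * (f (m + n) - f n) <= C * f n)%N &
    (n * (f (m + (n + n)) - f (n + n)) <= C * f (n + n))%N].
Proof.
(* With 127, the [k] steps of length [m] from N = m k to 2 N, each adding at least C / (2 N) times
   [phi N], add up to 127 times [phi N]. *)
move=> m0 f0 fmono [N0 fcub]; pose C := (2 * m * 127)%N.
exists C; first by rewrite !muln_gt0 m0.
move=> n0; apply: contrapT => /forallNP nex.
pose phi n := (f n * f (n + n))%N.
have phi0 n : (0 < phi n)%N by rewrite muln_gt0 !f0.
have phi_mono i j : (i <= j)%N -> (phi i <= phi j)%N.
  by move=> ij; rewrite leq_mul ?fmono ?leq_add.
have step n : (n0 <= n)%N -> ((n + C) * phi n <= n * phi (m + n))%N.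
  move=> n0n; have fa : (f n <= f (m + n))%N by rewrite fmono ?leq_addl.
  have fb : (f (n + n) <= f (m + (n + n)))%N by rewrite fmono ?leq_addl.
  have fc : (f (m + (n + n)) <= f (m + n + (m + n)))%N by apply: fmono; lia.
  rewrite /phi; move: fa fb fc (nex n).
  set a := f n; set b := f (n + n); set a' := f (m + n).
  set b' := f (m + (n + n)); set b'' := f (m + n + (m + n)) => fa fb fc nx.
  have [h1|h1] := leqP (n * (a' - a)) (C * a).
    have [h2|h2] := leqP (n * (b' - b)) (C * b); first by case: nx.
    have h3 : ((n + C) * b <= n * b'')%N.
      have : ((n + C) * b <= n * b')%N by move: h2; rewrite mulnBr mulnDl; lia.
      by move/leq_trans; apply; rewrite leq_mul2l fc orbT.
    by rewrite mulnCA [leqRHS]mulnCA leq_mul.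
  have h3 : ((n + C) * a <= n * a')%N by move: h1; rewrite mulnBr mulnDl; lia.
  by rewrite !mulnA leq_mul // (leq_trans fb).
have double k : (n0 <= m * k)%N -> (0 < k)%N -> (128 * phi (m * k) <= phi (m * (k + k)))%N.
  move=> n0k k0; pose N := (m * k)%N.
  have incr i : (i <= k)%N ->
      (2 * N * phi N + i * (C * phi N) <= 2 * N * phi (N + m * i))%N.
    elim: i => [|i IH] ik; first by rewrite mul0n muln0 !addn0.
    have {}IH := IH (ltnW ik).
    have iN : (m * i <= N)%N by rewrite leq_mul2l ltnW ?orbT.
    have := step (N + m * i)%N (leq_trans n0k (leq_addr _ _)).
    have -> : (m + (N + m * i) = N + m * i.+1)%N by rewrite mulnS; lia.
    have := phi_mono N (N + m * i)%N (leq_addr _ _).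
    have N_gt0 : (0 < N)%N by rewrite muln_gt0 m0.
    move: IH iN; set p := phi N; set q := phi (N + m * i)%N; set q' := phi _.
    set t := (m * i)%N => IH tN pq st.
    have ge : (q <= q')%N.
      have Nt : (0 < N + t)%N by rewrite addn_gt0 N_gt0.
      by rewrite -(leq_pmul2l Nt); apply: leq_trans st; rewrite leq_mul2r leq_addr orbT.
    have st' : (C * q <= (N + t) * (q' - q))%N by rewrite mulnBr; move: st; rewrite mulnDl; lia.
    have st2 : ((N + t) * (q' - q) <= 2 * N * (q' - q))%N by rewrite leq_mul2r; apply/orP; right; lia.
    have st3 : (C * p <= C * q)%N by rewrite leq_mul2l pq orbT.
    move: st2; rewrite mulnBr => st2; rewrite mulSn.
    have : (2 * N * q <= 2 * N * q')%N by rewrite leq_mul2l ge orbT.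
    lia.
  have := incr k (leqnn k).
  have -> : (N + m * k = m * (k + k))%N by rewrite mulnDr.
  rewrite -/N /C; set p := phi N; set q := phi _ => H.
  have Hm : (0 < 2 * N)%N by rewrite !muln_gt0 m0.
  rewrite -(leq_pmul2l Hm); apply: leq_trans H; rewrite /N; nia.
pose k0 := n0.+1.
have pow j : (128 ^ j <= phi (m * (k0 * 2 ^ j)))%N.
  elim: j => [|j IH]; first by rewrite expn0 phi0.
  have -> : (k0 * 2 ^ j.+1 = k0 * 2 ^ j + k0 * 2 ^ j)%N by rewrite expnS; lia.
  have kj : (0 < k0 * 2 ^ j)%N by rewrite muln_gt0 expn_gt0.
  apply: leq_trans (double _ _ kj).
    by rewrite expnS leq_mul2l IH orbT.
  apply: (@leq_trans (k0 * 2 ^ j)%N); last by rewrite leq_pmull.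
  by apply: (@leq_trans k0); rewrite ?leqnSn // leq_pmulr // expn_gt0.
(* The cubic bound gives phi(x) <= B 64^j for x = m k0 2^j; this [j] makes 2^j exceed [B] and x
   reach [N0]. *)
pose B := (8 * (m * k0) ^ 6)%N; pose j := maxn N0 B.
have jN : (j < 2 ^ j)%N by apply: ltn_expl.
have N0j : (N0 <= m * (k0 * 2 ^ j))%N.
  apply: (@leq_trans (2 ^ j)%N); first by apply: leq_trans (ltnW jN); apply: leq_maxl.
  by rewrite mulnA leq_pmull // muln_gt0 m0.
have := pow j; rewrite /phi; set x := (m * _)%N.
have xE : x = ((m * k0) * 2 ^ j)%N by rewrite /x mulnA.
have := fcub x N0j; have := fcub (x + x)%N (leq_trans N0j (leq_addr _ _)) => h1 h2 h3.
have : (128 ^ j <= x ^ 3 * (x + x) ^ 3)%N by apply: leq_trans h3 _; apply: leq_mul.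
have -> : (x ^ 3 * (x + x) ^ 3 = B * 64 ^ j)%N.
  have -> : (64 = 2 ^ 6)%N by [].
  rewrite addnn -muln2 expnMn mulnA -expnD xE expnMn -expnM [(j * 6)%N]mulnC expnM /B; lia.
have -> : (128 ^ j = 2 ^ j * 64 ^ j)%N by rewrite -expnMn.
rewrite leq_pmul2r ?expn_gt0 // leqNgt; apply/negP; rewrite negbK.
by apply: leq_ltn_trans jN; apply: leq_maxr.
Qed.

(** As n / 4C <= r <= n / 2C, each r t is at most half of its f. The excluded inequality would give
    r^2 (n + 1) <= 2 f2, hence n^3 <= 32 C^2 f2 and (2n)^3 <= 256 C^2 f2, just short of the assumed
    (256 C^2 + 1) f2. *)
Lemma final_count (C n r f1 f2 t1 t2 : nat) : (0 < C)%N -> (2 * C <= n)%N ->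
  (0 < f1)%N -> (0 < f2)%N -> r = (n %/ (2 * C))%N ->
  (n * t1 <= C * f1)%N -> (n * t2 <= C * f2)%N ->
  ((256 * C ^ 2 + 1) * f2 <= (n + n) ^ 3)%N ->
  (r * t1 < f1)%N /\ ~ (r * r * n.+1 <= f2 + r * t2)%N.
Proof.
move=> C0 Cn f10 f20 rE h1 h2 h3.
have rn : (2 * C * r <= n)%N by rewrite rE mulnC leq_divM.
have r0 : (0 < r)%N by rewrite rE divn_gt0 // muln_gt0.
have nr : (n <= 4 * C * r)%N.
  have : (n < r.+1 * (2 * C))%N by rewrite rE ltn_ceil // muln_gt0.
  by rewrite mulSn; nia.
have half f t : (n * t <= C * f)%N -> (2 * (r * t) <= f)%N.
  move=> h; rewrite -(leq_pmul2l C0); apply: leq_trans h.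
  by apply: (@leq_trans (2 * C * r * t)%N); [lia|rewrite leq_mul2r rn orbT].
have g1 := half _ _ h1; have g2 := half _ _ h2.
split=> [|H]; first by lia.
have {}H : (r * r * n.+1 <= 2 * f2)%N by apply: leq_trans H _; lia.
have n2 : (n * n <= 16 * C ^ 2 * (r * r))%N.
  apply: (@leq_trans ((4 * C * r) * (4 * C * r))%N); first exact: leq_mul.
  by rewrite expnS expn1; lia.
have n3 : (n * n * n <= 32 * C ^ 2 * f2)%N.
  apply: (@leq_trans (16 * C ^ 2 * (r * r) * n.+1)%N); first by rewrite leq_mul.
  rewrite -mulnA; apply: (@leq_trans (16 * C ^ 2 * (2 * f2))%N); last by lia.
  by rewrite leq_mul2l H orbT.
have : ((n + n) ^ 3 = 8 * (n * n * n))%N by rewrite !expnS expn0; lia.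
move: h3; rewrite mulnDl mul1n; lia.
Qed.

(** * Contradiction between the two counts *)

Unset Implicit Arguments.

Theorem theorem1p3 (K : fieldType) (Q : unitAlgType K) (A : Q -> Prop)
  (s : seq Q) :
  generated_by A s ->
  (gk_growth s < 3%:E)%E ->
  is_quotient_division_algebra_of A ->
  forall D : Q -> Prop, is_division_subalgebra D ->
  (2%:E <= GKdim D)%E ->
  left_fin_dim_over D.
Proof.
move=> As gkA QA D Ddiv gkD; apply: contrapT => Dinf.
have Acubic := subcubic (growth_gt0 s) gkA.
(* [GKdim D] is a supremum, so a finite family in [D] already has growth above 3/2, a value chosen
   between 1 and 2 to exclude linear growth. *)
have [s' [Ds' gks']] : exists s' : seq Q, (forall x, x \in s' -> D x) /\
    ((3 / 2)%:E < gk_growth s')%E.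
  have /ereal_sup_gt[_ [s' Ds' <-] gks'] : ((3 / 2)%:E < GKdim D)%E.
    by apply: lt_le_trans gkD; rewrite lte_fin; lra.
  by exists s'.
have Dsuper := superlinear (growth_gt0 s') gks'.
have Dsub : is_subalgebra D by case: Ddiv.
pose w (c : 'I_(size s').+1) := (1 :: s')`_c.
have ws' c : w c \in 1 :: s' by apply: mem_nth.
have branch : forall m j, (j < m)%N -> exists v v',
    [/\ reduced w v, reduced w v', size v = m, size v' = m &
        take j v = take j v' /\ wsum (take j.+1 v) <> wsum (take j.+1 v')].
  apply: reduced_branch => // c; have [n cn] := Dsuper c; exists n.
  apply: leq_trans cn _; apply: leq_dimspan_span => x xn.
  by apply/kspan_mem/pow_gens_wordp.
have [g [g1 g2 g3]] := ex_normal_form w.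
have g_tri u v : reduced w v -> size u = size v -> g u v != 0 ->
    u = v \/ (wval u < wval v)%N by move=> _ _ /g2[].
have good := ex_good g1 g_tri (@reduced_nil _ _ _ w) branch.
have [b [m [b0 bm]]] := bounded_denominator As QA s'.
(* The exponent is raised to [m.+1] because [ex_folner_scale] asks for a positive shift. *)
have {}bm x : x \in 1 :: s' -> kspan (pow_gens s m.+1) (x * b).
  by move=> /bm; apply: kspan_pow_mono.
have [C C0 Cscale] : exists2 C, (0 < C)%N & forall n0, exists n, [/\ (n0 <= n)%N,
    (n * (growth_fun s (m.+1 + n) - growth_fun s n) <= C * growth_fun s n)%N &
    (n * (growth_fun s (m.+1 + (n + n)) - growth_fun s (n + n))
       <= C * growth_fun s (n + n))%N].
  apply: ex_folner_scale => //; [exact: growth_gt0|exact: growth_mono|].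
  by have [N NP] := Acubic 1%N; exists N => n /NP; rewrite mul1n.
have [N NP] := Acubic (256 * C ^ 2 + 1)%N.
have [n [nN n1 n2]] := Cscale (maxn N (2 * C))%N.
move: nN; rewrite geq_max => /andP[Nn Cn].
have [E [T [Efree sE sT wE [Eb bE]]]] := ex_folner QA n b0 bm.
have [E2 [T2 [_ sE2 sT2 wE2 [_ bE2]]]] := ex_folner QA (n + n) b0 bm.
have [|||||rT] := @final_count C n (n %/ (2 * C))%N (growth_fun s n)
  (growth_fun s (n + n)) (size T) (size T2) C0 Cn _ _ erefl.
- exact: growth_gt0.
- exact: growth_gt0.
- by apply: leq_trans n1; rewrite leq_mul2l leq_subRL ?growth_mono ?leq_addl // addnC sT orbT.
- by apply: leq_trans n2; rewrite leq_mul2l leq_subRL ?growth_mono ?leq_addl // addnC sT2 orbT.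
- by apply: NP; apply: leq_trans Nn _; apply: leq_addr.
set r := (n %/ _)%N in rT *; apply; rewrite -sE2.
have [x [y xy]] := good (r + r)%N.
apply: (core_count (w := w) (x := x) (y := y) (E := E) (T := T) (U := pow_gens s n) Dsub).
- move=> c; move: (ws' c); rewrite inE => /predU1P[->|/Ds'//].
  by case: Dsub.
- exact: (tree_free g1 g2 g3 xy).
- exact: Efree.
- by rewrite sE.
- by move=> c e; apply: wE.
- by move=> c e; apply: wE2.
(* b V^n V^n lies in b V^(2n), which is why the second scale is [n + n]. *)
- move=> e u /Eb[z zn ->] un; rewrite -mulrA; apply: bE2.
  by apply: kspan_powD; apply: kspan_mem.
- by move=> h h0; apply: (ex_dfree As QA Ddiv Dinf n h0).
Qed.
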